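(* Let $M$ be a closed connected smooth manifold with a positive measure, let $e_1,\dots,e_d$ be smooth vector fields on $M$, and let $L=\sum_{j=1}^d e_j^2$. Let $$\{Y_\alpha\}_{\alpha\in\Lambda}:=\{Y'_\eta=[e_i,e_j]\}_{i,j\in\{1,\dots,d\}}\cup\{Y''_A=[e_i,[e_j,e_k]]\}_{i,j,k\in\{1,\dots,d\}},$$ and suppose that $\{e_i\}_{1\le i\le d}$ and $\{Y_\alpha\}_{\alpha\in\Lambda}$ together span the tangent space of $M$ at every point. Assume that $$[e_i,[e_j,[e_k,e_l]]]=a_{ijkl}^n e_n+b_{ijkl}^\eta Y'_\eta+c_{ijkl}^A Y''_A$$ (summation over repeated indices $n,\eta,A$) for functions $a_{ijkl}^n,b_{ijkl}^\eta,c_{ijkl}^A\in C^\infty(M)$, and that $M$ satisfies the generalized curvature-dimension inequality $CD(\rho_1,\rho_2,\kappa,m)$ for some $\rho_1\in\mathbb{R}$, $\rho_2>0$, $\kappa\ge0$, $m>0$. Suppose that $u$ is a positive solution of $$\Big(L-\frac{\partial}{\partial t}\Big)u=0\quad\text{on } M\times[0,+\infty).$$ Then for every $\lambda$ with $\frac12<\lambda<\frac23$ there exists $\delta_0=\delta_0(\lambda,\rho_1,\rho_2,\kappa,d,h)>1$ such that for any $\delta>\delta_0$, on $M\times(0,\infty)$, $$\sum_{j=1}^d\frac{|e_ju|^2}{u^2}+\sum_{\alpha\in\Lambda}\left(1+\frac{|Y_\alpha u|^2}{u^2}\right)^{\lambda}-\delta\frac{u_t}{u}\le\frac{C_1}{t}+C_2+C_3\,t^{\frac{\lambda}{\lambda-1}},$$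 where $C_1,C_2,C_3$ are positive constants depending only on $d,\lambda,\delta,a,a',b,b',c,c',\rho_1,\rho_2,\kappa,m$.
   Context: The manifold satisfies the generalized curvature-dimension inequality $CD(\rho_1,\rho_2,\kappa,m)$ (with respect to $\{e_i\},\{Y_\alpha\}_{\alpha\in\Lambda}$) if for every $f\in C^\infty(M)$ and every $\nu>0$, pointwise on $M$, $$\frac1m(Lf)^2+\Big(\rho_1-\frac{\kappa}{\nu}\Big)\Gamma(f,f)+\rho_2\Gamma^Z(f,f)\le\Gamma_2(f,f)+\nu\,\Gamma_2^Z(f,f),$$ where $$\Gamma(f,f)=\sum_{j=1}^d|e_jf|^2,\qquad \Gamma^Z(f,f)=\sum_{\alpha\in\Lambda}|Y_\alpha f|^2,$$ $$\Gamma_2(f,f)=\tfrac12\Big[L(\Gamma(f,f))-2\sum_{j=1}^d(e_jf)(e_jLf)\Big],\qquad \Gamma_2^Z(f,f)=\tfrac12\Big[L(\Gamma^Z(f,f))-2\sum_{\alpha\in\Lambda}(Y_\alpha f)(Y_\alpha Lf)\Big].$$ The constants are $a=\sup|a_{ijkl}^n|$, $b=\sup|b_{ijkl}^\eta|$, $c=\sup|c_{ijkl}^A|$, $a'=\sup|e_pa_{ijkl}^n|$, $b'=\sup|e_pb_{ijkl}^\eta|$, $c'=\sup|e_pc_{ijkl}^A|$, the suprema being over $M$ and all indices. The integer $h$ is the number such that $d+h=\dim M$. $u_t=\partial u/\partial t$. *)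

(* Defs.v *)
From HB Require Import structures.
From mathcomp Require Import all_boot all_order all_algebra.
From mathcomp Require Import all_classical all_reals all_analysis.
Import Order.TTheory GRing.Theory Num.Theory.
Import numFieldNormedType.Exports.

Set Implicit Arguments.
Unset Strict Implicit.
Unset Printing Implicit Defensive.

Local Open Scope classical_set_scope.
Local Open Scope ring_scope.

Section SmoothMaps.
Context {R : realType} {V W : normedModType R}.

(* For V finite-dimensional and U open this is the usual class C^k: all
   iterated directional derivatives of order at most k exist and are
   continuous on U. *)
Fixpoint Ck (k : nat) (U : set V) (f : V -> W) : Prop :=
  (forall x, U x -> {for x, continuous f}) /\
  (if k is k'.+1 then
     forall v : V, (forall x, U x -> derivable f x v) /\ Ck k' U ('D_v f)
   else True).

Definition smooth_on (U : set V) (f : V -> W) : Prop := forall k, Ck k U f.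

End SmoothMaps.

(* The function [cmap] (resp. [cinv]) is only meaningful on [cdom] (resp. on
   [cimg]). *)
Record chart (R : realType) (n : nat) (M : topologicalType) := Chart {
  cdom : set M;
  cmap : M -> 'rV[R]_n;
  cinv : 'rV[R]_n -> M;
  cdom_open : open cdom;
  cimg_open : open (cmap @` cdom);
  cmap_continuous : {within cdom, continuous cmap};
  cinv_continuous : {within cmap @` cdom, continuous cinv};
  cmapK : forall p, cdom p -> cinv (cmap p) = p }.

Definition cimg (R : realType) n (M : topologicalType) (c : chart R n M)
  : set 'rV[R]_n := cmap c @` cdom c.

Section Manifold.
Context {R : realType} {n : nat} {M : topologicalType}.
Variable A : set (chart R n M).

Definition smooth_atlas : Prop :=
  (forall p, exists2 c, A c & cdom c p) /\
  (forall c c', A c -> A c' ->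
     smooth_on (cmap c @` (cdom c `&` cdom c')) (cmap c' \o cinv c)).

Definition closed_connected_manifold : Prop :=
  [/\ hausdorff_space M, compact [set: M], connected [set: M]
    & smooth_atlas].

Definition smooth (f : M -> R) : Prop :=
  forall c, A c -> smooth_on (cimg c) (f \o cinv c).

(* Tangent vectors at p are derivations at p of the algebra of smooth
   functions. *)
Definition tangent_vector (p : M) (v : (M -> R) -> R) : Prop :=
  (forall (k : R) (f g : M -> R), smooth f -> smooth g ->
     v (fun q => k * f q + g q) = k * v f + v g) /\
  (forall f g : M -> R, smooth f -> smooth g ->
     v (fun q => f q * g q) = v f * g p + f p * v g).

(* A smooth vector field, identified with its action f |-> X f on smooth
   functions: in every chart, X is the sum of the b_i d/dx_i with smooth
   components b_i.  The values of X on non-smooth functions are irrelevant. *)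
Definition vector_field (X : (M -> R) -> (M -> R)) : Prop :=
  forall c, A c ->
  exists2 b : 'rV[R]_n -> 'rV[R]_n, smooth_on (cimg c) b &
    forall f, smooth f -> forall p, cdom c p ->
      X f p = \sum_(i < n)
        b (cmap c p) 0 i * 'D_(delta_mx 0 i) (f \o cinv c) (cmap c p).

(* Continuous on M x [0, oo) and smooth on M x (0, oo). *)
Definition spacetime_regular (u : M -> R -> R) : Prop :=
  {within [set z : M * R | 0 <= z.2], continuous (fun z => u z.1 z.2)} /\
  (forall c, A c ->
     smooth_on [set z : 'rV[R]_n * R | cimg c z.1 /\ 0 < z.2]
               (fun z => u (cinv c z.1) z.2)).

End Manifold.

Definition bracket (R : realType) (M : Type)
    (X Y : (M -> R) -> (M -> R)) : (M -> R) -> (M -> R) :=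
  fun f p => X (Y f) p - Y (X f) p.

Definition idx2 (d : nat) : finType := ('I_d * 'I_d)%type.
Definition idx3 (d : nat) : finType := ('I_d * 'I_d * 'I_d)%type.
Definition idx4 (d : nat) : finType := ('I_d * 'I_d * 'I_d * 'I_d)%type.

(* The index set Lambda: all pairs (i, j) and all triples (i, j, k), so that
   (Y_alpha) is an indexed family, possibly with repetitions. *)
Definition Lam (d : nat) : finType := (idx2 d + idx3 d)%type.

Section SubLaplacian.
Context {R : realType} {d : nat} {M : Type}.
Variable e : 'I_d -> (M -> R) -> (M -> R).

Definition Y' (q : idx2 d) : (M -> R) -> (M -> R) :=
  let: (i, j) := q in bracket (e i) (e j).

Definition Y'' (q : idx3 d) : (M -> R) -> (M -> R) :=
  let: (i, j, k) := q in bracket (e i) (bracket (e j) (e k)).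

Definition Y (al : Lam d) : (M -> R) -> (M -> R) :=
  match al with inl q => Y' q | inr q => Y'' q end.

Definition bracket4 (q : idx4 d) : (M -> R) -> (M -> R) :=
  let: (i, j, k, l) := q in
  bracket (e i) (bracket (e j) (bracket (e k) (e l))).

Definition L (f : M -> R) : M -> R := fun p => \sum_(j < d) e j (e j f) p.

Definition Gamma (f : M -> R) : M -> R :=
  fun p => \sum_(j < d) `|e j f p| ^+ 2.

Definition GammaZ (f : M -> R) : M -> R :=
  fun p => \sum_(al : Lam d) `|Y al f p| ^+ 2.

Definition Gamma2 (f : M -> R) : M -> R :=
  fun p => 2^-1 *
    (L (Gamma f) p - 2 * \sum_(j < d) e j f p * e j (L f) p).

Definition Gamma2Z (f : M -> R) : M -> R :=
  fun p => 2^-1 *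
    (L (GammaZ f) p - 2 * \sum_(al : Lam d) Y al f p * Y al (L f) p).

End SubLaplacian.

Section Conditions.
Context {R : realType} {n d : nat} {M : topologicalType}.
Variables (A : set (chart R n M)) (e : 'I_d -> (M -> R) -> (M -> R)).

Definition spans_tangent_space : Prop :=
  forall (p : M) (v : (M -> R) -> R), tangent_vector A p v ->
  exists (x : 'I_d -> R) (y : Lam d -> R), forall f, smooth A f ->
    v f = \sum_(j < d) x j * e j f p + \sum_(al : Lam d) y al * Y e al f p.

Definition CD (rho1 rho2 kappa m : R) : Prop :=
  forall f, smooth A f -> forall nu : R, 0 < nu -> forall p : M,
    m^-1 * L e f p ^+ 2 + (rho1 - kappa / nu) * Gamma e f p
      + rho2 * GammaZ e f p
    <= Gamma2 e f p + nu * Gamma2Z e f p.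

Definition bracket4_expansion
    (a : idx4 d -> 'I_d -> M -> R)
    (b : idx4 d -> idx2 d -> M -> R)
    (c : idx4 d -> idx3 d -> M -> R) : Prop :=
  forall q f, smooth A f -> forall p : M,
    bracket4 e q f p =
      \sum_(k < d) a q k p * e k f p
      + \sum_(eta : idx2 d) b q eta p * Y' e eta f p
      + \sum_(B : idx3 d) c q B p * Y'' e B f p.

End Conditions.

Definition sup_coef (R : realType) (I J M : Type) (F : I -> J -> M -> R) : R :=
  sup [set x | exists i j p, x = `|F i j p|].

Definition sup_dcoef (R : realType) (d : nat) (I J M : Type)
    (e : 'I_d -> (M -> R) -> (M -> R)) (F : I -> J -> M -> R) : R :=
  sup [set x | exists k i j p, x = `|e k (F i j) p|].

(* Main.v *)
(** Li-Yau argument.  With [f = ln u], one has [f_t = L f + Gamma f]; put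
    [X = Gamma f], [W = 1 + sum_al |Y_al f|^2],
    [S = sum_al (1 + |Y_al f|^2)^lam], [G = X + S - delta f_t] and
    [cL g = L g - g_t + 2 sum_j (e_j f) (e_j g)].  Then [cL f_t = 0] and
    [cL X = 2 Gamma2 f]; one copy of [Gamma2 f] is expanded by Bochner, the
    other one is bounded below by CD with [nu = eps W^(lam-1)], where
    [eps = lam (2 lam - 1)] is half the coefficient of the good term
    [W^(lam-1) sum |e_j Y_al f|^2] of [cL S].  Since iterated brackets of length
    four reduce to shorter ones, all commutators are controlled, and
      [cL G >= (L f)^2 / m + rho2 W - Cs X W^(1-lam)
               - C (X W^(lam/2) + W^(3 lam/2))]
    with [Cs] independent of the structure functions.  At a positive maximum of
    [(t - s)^2 G] on [M x [s, T]] with [s = T/2] one has [cL G <= 2 G / (t - s)].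
    If [G + (delta-1) X <= 2 S], then [X] is at most
    [const W^lam / (delta - 1)], so that for large [delta] the term [rho2 W]
    absorbs the others ([3 lam / 2 < 1]) and [W^(1-lam) <= C + C / (t - s)];
    otherwise [(L f)^2] dominates [G^2 + X^2], and [2 - 2 lam < 1] gives
    [G <= C + C / (t - s)]. *)

Require Import Defs.
From mathcomp Require Import all_boot all_order all_algebra.
From mathcomp Require Import all_classical all_reals all_analysis.
From mathcomp Require Import ring lra.
Import Order.TTheory GRing.Theory Num.Theory.
Import numFieldNormedType.Exports.

Set Implicit Arguments.
Unset Strict Implicit.
Unset Printing Implicit Defensive.

Local Open Scope classical_set_scope.
Local Open Scope ring_scope.

(** * Directional derivatives along lines *)

Section DirectionalDerivatives.
Context {R : realType} {V : normedModType R}.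
Implicit Types (U : set V) (f g : V -> R) (x v : V).

(** The choice of [nu] is forced. CD carries [nu * Gamma2Z] on its larger side, so [Gamma2Z] must be
    bounded above; that bound contains [nu * sum |e_j Y_al f|^2], which only the good term of [cL S]
    can pay for. CD consumes half of that term and the other half absorbs commutators. The price is
    [kappa / nu * X], of order [X W^(1-lam)]: the critical term.

    The Bochner copy is kept for [sum |e_i e_j f|^2], because commuting [L] with a triple bracket
    produces second derivatives [e_i e_j f].

    The obstacle is that [delta0] is fixed before the structure functions. The critical term sees
    only the commutators [[L, e_i]], which are made of the [Y_al] themselves with universal
    coefficients. Structure functions enter through [[L, Y_al]] and [[e_j, Y_al]], whose factor
    [W^(lam-1/2)] makes them lower order.

    The time interval starts at [T/2] because smoothness is known only at positive times. The weight
    is squared because the bound at the maximum is a multiple of [1 + tau^(lam/(lam-1))], and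
    [2 + lam/(lam-1)] is positive exactly when [lam < 2/3]; the bound therefore carries over to time
    [T]. *)

Lemma is_derive_line {W : normedModType R} (f : V -> W) x v df (t : R) :
  is_derive (t *: v + x) v f df <->
  is_derive t (1 : R) (fun h : R => f (h *: v + x)) df.
Proof.
have E : (fun h : R => h^-1 *: ((f \o shift (t *: v + x)) (h *: v)
                                - f (t *: v + x))) =
    (fun h : R => h^-1 *: (((fun h : R => f (h *: v + x)) \o shift t) (h *: 1)
                           - f (t *: v + x))).
  apply/funext => h /=; rewrite [(h *: 1 : R)]mulr1 scalerDl addrA //.
by split=> -[d1 d2]; split; rewrite /derivable /derive ?E// -?E.
Qed.

Lemma is_derive_line0 {W : normedModType R} (f : V -> W) x v df :
  is_derive x v f df <-> is_derive (0 : R) (1 : R) (fun h : R => f (h *: v + x)) df.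
Proof. by rewrite -is_derive_line scale0r add0r. Qed.

(** Restricting [f] to the line through [x] along [v] leaves the one-variable chain rule, so no
    total differentiability of [f] is required. *)
Lemma is_derive_comp_dir (phi : R -> R) f x v a b :
  is_derive (f x) (1 : R) phi a -> is_derive x v f b ->
  is_derive x v (phi \o f) (a * b).
Proof.
move=> dphi /is_derive_line0 df; apply/is_derive_line0.
have := @is_derive1_comp R phi (fun h : R => f (h *: v + x)) 0 a b.
by apply => //; rewrite scale0r add0r.
Qed.

Lemma continuous_line_pt (x v : V) (t : R) :
  {for t, continuous (fun h : R => h *: v + x)}.
Proof.
apply: cvgD; last exact: cvg_cst.
by apply: cvgZr_tmp.
Qed.

Lemma near_open_eq {T : topologicalType} {S : Type} (U : set T) (f g : T -> S) (x : T) :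
  open U -> U x -> (forall y, U y -> f y = g y) -> \near x, f x = g x.
Proof. by move=> oU Ux fg; apply: filterS (open_nbhs_nbhs (conj oU Ux)). Qed.

Lemma continuous_open_ext {T W : topologicalType} (U : set T) (f g : T -> W) (x : T) :
  open U -> U x -> (forall y, U y -> f y = g y) ->
  {for x, continuous f} -> {for x, continuous g}.
Proof.
move=> oU Ux fg cf; change (g @ x --> g x); rewrite -(fg x Ux).
by apply: cvg_trans cf; apply: near_eq_cvg; apply: near_open_eq oU Ux _.
Qed.

End DirectionalDerivatives.

(** * Closure properties of the class [Ck] *)

Section CkCalculus.
Context {R : realType} {V : normedModType R}.
Implicit Types (U : set V) (f g : V -> R) (x v : V).

Lemma CkS_derive {W : normedModType R} k U (f : V -> W) x v :
  Ck k.+1 U f -> U x -> is_derive x v f ('D_v f x).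
Proof. by move=> [_ /(_ v) [df _]] Ux; apply: derivableP; exact: df. Qed.

Lemma Ck_pred {W : normedModType R} k U (f : V -> W) : Ck k.+1 U f -> Ck k U f.
Proof.
elim: k f => [|k IH] f; first by case=> cf _; split.
move=> [cf df]; split=> // v; have [d1 d2] := df v; split=> //; exact: IH.
Qed.

(** The product, power and logarithm rules give a formula for ['D_v] only at points of [U]; this
    lemma turns such a formula into membership in [Ck]. *)
Lemma Ck_ext {W : normedModType R} k U (f g : V -> W) : open U ->
  (forall x, U x -> f x = g x) -> Ck k U f -> Ck k U g.
Proof.
move=> oU; elim: k f g => [|k IH] f g fg [cf df].
  by split=> // x Ux; apply: continuous_open_ext oU Ux fg (cf x Ux).
split=> [x Ux|v]; first by apply: continuous_open_ext oU Ux fg (cf x Ux).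
have [d1 d2] := df v; split=> [x Ux|].
  by apply: (@near_eq_derivable _ _ _ f) (d1 x Ux); apply: (@near_open_eq _ _ U).
apply: IH d2 => x Ux.
by apply: near_eq_derive; apply: (@near_open_eq _ _ U).
Qed.

Lemma Ck_cst {W : normedModType R} k U (a : W) : Ck k U (fun=> a : W).
Proof.
elim: k a => [|k IH] a; first by split=> // x _; exact: cvg_cst.
split=> [x _|v]; first exact: cvg_cst.
split=> [x _|]; first exact: derivable_cst.
by have -> : 'D_v (fun=> a) = (fun=> 0 : W) by apply/funext => x; exact: derive_cst.
Qed.

Lemma Ck_D k U f g : open U -> Ck k U f -> Ck k U g -> Ck k U (fun x => f x + g x).
Proof.
move=> oU; elim: k f g => [|k IH] f g [cf df] [cg dg].
  by split=> // x Ux; apply: cvgD; [exact: cf|exact: cg].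
split=> [x Ux|v]; first by apply: cvgD; [exact: cf|exact: cg].
have [d1 d2] := df v; have [e1 e2] := dg v; split=> [x Ux|].
  by apply: derivableD; [exact: d1|exact: e1].
apply: (@Ck_ext _ _ _ (fun x => 'D_v f x + 'D_v g x)) => // [x Ux|]; last exact: IH.
by rewrite deriveD //; [exact: d1|exact: e1].
Qed.

Lemma Ck_M k U f g : open U -> Ck k U f -> Ck k U g -> Ck k U (fun x => f x * g x).
Proof.
move=> oU; elim: k f g => [|k IH] f g Cf Cg.
  have [cf _] := Cf; have [cg _] := Cg.
  by split=> // x Ux; apply: cvgM; [exact: cf|exact: cg].
have [cf df] := Cf; have [cg dg] := Cg.
split=> [x Ux|v]; first by apply: cvgM; [exact: cf|exact: cg].
have [d1 d2] := df v; have [e1 e2] := dg v; split=> [x Ux|].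
  by apply: derivableM; [exact: d1|exact: e1].
apply: (@Ck_ext _ _ _ (fun x => f x * 'D_v g x + g x * 'D_v f x)) => // [x Ux|].
  by rewrite (@deriveM _ _ f g) //; [exact: d1|exact: e1].
by apply: Ck_D => //; apply: IH => //; exact: Ck_pred.
Qed.

Lemma Ck_sum k U (I : Type) (r : seq I) (P : pred I) (F : I -> V -> R) : open U ->
  (forall i, P i -> Ck k U (F i)) -> Ck k U (fun x => \sum_(i <- r | P i) F i x).
Proof.
move=> oU CF; elim: r => [|i r IH].
  apply: (@Ck_ext _ _ _ (fun=> 0)) => // [x _|]; last exact: Ck_cst.
  by rewrite big_nil.
case Pi : (P i); last by apply: Ck_ext IH => // x _; rewrite big_cons Pi.
apply: (@Ck_ext _ _ _ (fun x => F i x + \sum_(j <- r | P j) F j x)) => //.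
  by move=> x _; rewrite big_cons Pi.
by apply: Ck_D => //; exact: CF.
Qed.

Lemma continuous_powR (a x : R) : 0 < x -> {for x, continuous (fun y : R => y `^ a)}.
Proof.
move=> x0; apply/differentiable_continuous/derivable1_diffP.
by have [] := @is_derive1_powR R a x x0.
Qed.

Lemma continuous_ln_pos (x : R) : 0 < x -> {for x, continuous (@ln R)}.
Proof.
move=> x0; apply/differentiable_continuous/derivable1_diffP.
by have [] := @is_derive1_ln R x x0.
Qed.

(** The induction must cover all exponents at once, since the derivative of the power [a] involves
    the power [a - 1]. *)
Lemma Ck_powR k U f a : open U -> (forall x, U x -> 0 < f x) ->
  Ck k U f -> Ck k U (fun x => f x `^ a).
Proof.
move=> oU f0; elim: k a f f0 => [|k IH] a f f0 Cf.
  have [cf _] := Cf; split=> // x Ux.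
  exact: (@continuous_comp _ _ _ f _ _ (cf x Ux) (@continuous_powR a _ (f0 _ Ux))).
have [cf df] := Cf; split=> [x Ux|v].
  exact: (@continuous_comp _ _ _ f _ _ (cf x Ux) (@continuous_powR a _ (f0 _ Ux))).
have D x : U x -> is_derive x v (fun x => f x `^ a) (a * f x `^ (a - 1) * 'D_v f x).
  move=> Ux; apply: (@is_derive_comp_dir _ _ (fun y => y `^ a) f).
    by apply: is_derive1_powR; exact: f0.
  exact: CkS_derive Cf Ux.
split=> [x Ux|]; first by have [] := D x Ux.
apply: (@Ck_ext _ _ _ (fun x => a * f x `^ (a - 1) * 'D_v f x)) => // [x Ux|].
  by have [_ ->] := D x Ux.
apply: Ck_M => //; last exact: (df v).2.
by apply: Ck_M => //; [exact: Ck_cst|apply: IH => //; exact: Ck_pred].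
Qed.

Lemma Ck_ln k U f : open U -> (forall x, U x -> 0 < f x) ->
  Ck k U f -> Ck k U (fun x => ln (f x)).
Proof.
move=> oU f0; case: k => [|k] Cf.
  have [cf _] := Cf; split=> // x Ux.
  exact: (@continuous_comp _ _ _ f _ _ (cf x Ux) (@continuous_ln_pos _ (f0 _ Ux))).
have [cf df] := Cf; split=> [x Ux|v].
  exact: (@continuous_comp _ _ _ f _ _ (cf x Ux) (@continuous_ln_pos _ (f0 _ Ux))).
(* With the reciprocal written as the power [-1], [Ck_powR] applies and no second induction is
   needed. *)
have D x : U x -> is_derive x v (fun x => ln (f x)) (f x `^ (-1) * 'D_v f x).
  move=> Ux; rewrite powR_inv1; last by rewrite ltW // f0.
  apply: (@is_derive_comp_dir _ _ (@ln R) f).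
    by apply: is_derive1_ln; exact: f0.
  exact: CkS_derive Cf Ux.
split=> [x Ux|]; first by have [] := D x Ux.
apply: (@Ck_ext _ _ _ (fun x => f x `^ (-1) * 'D_v f x)) => // [x Ux|].
  by have [_ ->] := D x Ux.
apply: Ck_M => //; last exact: (df v).2.
by apply: Ck_powR => //; exact: Ck_pred.
Qed.

Lemma Ck_coord {m n : nat} k U (b : V -> 'M[R]_(m, n)) i j : open U ->
  Ck k U b -> Ck k U (fun x => b x i j).
Proof.
move=> oU; elim: k b => [|k IH] b [cb db].
  split=> // x Ux; apply: (@continuous_comp _ _ _ b (fun M => M i j)); first exact: cb.
  by apply: differentiable_continuous; exact: differentiable_coord.
split=> [x Ux|v].
  apply: (@continuous_comp _ _ _ b (fun M => M i j)); first exact: cb.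
  by apply: differentiable_continuous; exact: differentiable_coord.
have [d1 d2] := db v; split=> [x Ux|].
  by move/derivable_mxP : (d1 x Ux); apply.
apply: (@Ck_ext _ _ _ (fun x => 'D_v b x i j)) => // [x Ux|]; last exact: IH.
by rewrite derive_mx ?mxE//; exact: d1.
Qed.

End CkCalculus.

(** * Precomposition with affine maps *)

Section CkPrecomposition.
Context {R : realType} {V V' : normedModType R}.

(* [l] is an affine map with linear part [dl]. *)
Lemma derive_affine {W : normedModType R} (l : V' -> V) (dl : V' -> V)
  (f : V -> W) (z v : V') :
  (forall h : R, l (h *: v + z) = h *: dl v + l z) ->
  'D_v (f \o l) z = 'D_(dl v) f (l z) /\
  (derivable (f \o l) z v <-> derivable f (l z) (dl v)).
Proof.
move=> lE; suff E : (fun h => h^-1 *: (((f \o l) \o shift z) (h *: v) - (f \o l) z))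
  = (fun h => h^-1 *: ((f \o shift (l z)) (h *: dl v) - f (l z))).
  by rewrite /derive /derivable E.
by apply/funext => h /=; rewrite lE.
Qed.

Lemma Ck_affine (l : V' -> V) (dl : V' -> V) k U U' (f : V -> R) :
  open U' -> continuous l ->
  (forall (h : R) v z, l (h *: v + z) = h *: dl v + l z) ->
  (forall z, U' z -> U (l z)) ->
  Ck k U f -> Ck k U' (f \o l).
Proof.
move=> oU' cl lE lU; elim: k f => [|k IH] f [cf df].
  by split=> // z Uz; apply: continuous_comp; [exact: cl|apply: cf; exact: lU].
split=> [z Uz|v].
  by apply: continuous_comp; [exact: cl|apply: cf; exact: lU].
have A z := @derive_affine R l dl f z v (fun h => lE h v z).
have [d1 d2] := df (dl v); split=> [z Uz|].
  by apply/(A z).2; apply: d1; exact: lU.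
apply: (@Ck_ext _ _ _ _ _ ('D_(dl v) f \o l)) => // [z Uz|]; last exact: IH.
by rewrite (A z).1.
Qed.

End CkPrecomposition.

(** * Additivity in the direction, symmetry of second derivatives, interior maxima *)

Section SecondDerivatives.
Context {R : realType} {V : normedModType R}.
Implicit Types (U : set V) (f g : V -> R) (x v w : V).

Lemma and_lt_le (s a b : R) : a < s < b -> a <= s <= b.
Proof. by move=> /andP[? ?]; rewrite !ltW. Qed.

Lemma mvt_dir f x v (h : R) : 0 < h ->
  (forall s, 0 <= s <= h -> derivable f (s *: v + x) v) ->
  exists2 s, 0 < s < h & f (h *: v + x) - f x = h * 'D_v f (s *: v + x).
Proof.
move=> h0 df; pose g (s : R) := f (s *: v + x).
have dg s : 0 <= s <= h -> is_derive s (1 : R) g ('D_v f (s *: v + x)).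
  by move=> /df/derivableP/is_derive_line.
have [s + E] : exists2 s, s \in `]0, h[%R &
    g h - g 0 = 'D_v f (s *: v + x) * (h - 0).
  apply: (MVT h0) => [s|].
    by rewrite in_itv /= => /andP[s0 sh]; apply: dg; rewrite !ltW.
  apply: derivable_within_continuous => s; rewrite in_itv /= => sh.
  by have [] := dg s sh.
rewrite in_itv /= => sh; exists s => //.
by move: E; rewrite /g scale0r add0r subr0 mulrC.
Qed.

Lemma near_parallelogram (P : set V) x v w : nbhs x P ->
  \forall h \near (0:R)^'+, forall s s', 0 <= s <= h -> 0 <= s' <= h ->
    P (s *: v + (s' *: w + x)).
Proof.
move=> /nbhs_ballP[r /= r0 rP].
have N0 : 0 < `|v| + `|w| + 1 by rewrite ltr_wpDl // addr_ge0.
near=> h => s s' /andP[s0 sh] /andP[s'0 s'h].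
apply: rP; rewrite -ball_normE /ball_ /= addrA [s *: v + _ + x]addrC opprD addrA subrr sub0r normrN.
have hr : h * (`|v| + `|w| + 1) < r.
  rewrite -ltr_pdivlMr //; near: h; apply: nbhs_right_lt; exact: divr_gt0.
have h0 : 0 < h by near: h; exact: nbhs_right_gt.
apply: le_lt_trans hr; apply: le_trans (ler_normD _ _) _.
rewrite !normrZ (ger0_norm s0) (ger0_norm s'0) !mulrDr mulr1.
by rewrite -[leLHS]addr0 !lerD ?ler_wpM2r// ltW.
Unshelve. all: by end_near. Qed.

Lemma eq_of_close (a b : R) : (forall e, 0 < e -> `|a - b| <= e) -> a = b.
Proof.
move=> ab; apply/eqP; rewrite -subr_eq0 -normr_le0; apply/ler_addgt0Pr => e e0.
by rewrite add0r ab.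
Qed.

Lemma dist_sum_le (a b c p q e : R) : `|p + q - a| <= e / 3 ->
  `|p - b| <= e / 3 -> `|q - c| <= e / 3 -> `|a - (b + c)| <= e.
Proof.
rewrite !ler_norml => /andP[? ?] /andP[? ?] /andP[? ?]; apply/andP; split; lra.
Qed.

Lemma pos_of_close (a b : R) : 0 < b -> `|a - b| <= b / 2 -> 0 < a.
Proof. rewrite ler_norml => ? /andP[? ?]; lra. Qed.

Lemma dist_half_le (a b c e : R) : `|c - a| <= e / 2 -> `|c - b| <= e / 2 ->
  `|a - b| <= e.
Proof. rewrite !ler_norml => /andP[? ?] /andP[? ?]; apply/andP; split; lra. Qed.

Lemma derivable_right f x v : derivable f x v ->
  (fun h : R => h^-1 *: (f (h *: v + x) - f x)) @ 0^'+ --> 'D_v f x.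
Proof.
move=> df A /df /nbhs_ballP [_ /posnumP[e] eA].
by exists e%:num => //= y ye /gt_eqF/negbT/eA; exact.
Qed.

Lemma near_continuous_le (g : V -> R) x e : {for x, continuous g} -> 0 < e ->
  nbhs x [set y | `|g y - g x| <= e].
Proof.
move=> /cvgrPdist_le/(_ e) cg e0; have := cg e0.
by apply: filterS => y; rewrite /= distrC.
Qed.

Lemma near_difference_quotient f x v e : derivable f x v -> 0 < e ->
  \forall h \near (0 : R)^'+, `|h^-1 *: (f (h *: v + x) - f x) - 'D_v f x| <= e.
Proof.
move=> /derivable_right/cvgrPdist_le dq e0; have := dq e e0.
by apply: filterS => h; rewrite distrC.
Qed.

(** The step from [x] to [x + h (v + w)] is made in two legs, one along [w] and one along [v]. The
    mean value theorem on each leg gives a directional derivative at a nearby point, and continuity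
    of these derivatives at [x] concludes. *)
Lemma deriveDdir U f x v w : open U -> Ck 1 U f -> U x ->
  'D_(v + w) f x = 'D_v f x + 'D_w f x.
Proof.
move=> oU [cf df] Ux; apply: eq_of_close => e e0.
have e30 : 0 < e / 3 by rewrite divr_gt0.
have nU : nbhs x U by exact: open_nbhs_nbhs.
have c1 u : {for x, continuous ('D_u f)} by have [_ [c _]] := df u; exact: c.
have Pn : nbhs x (U `&` ([set y | `|'D_v f y - 'D_v f x| <= e / 3] `&`
                        [set y | `|'D_w f y - 'D_w f x| <= e / 3])).
  by do 2?[apply: filterI => //]; apply: near_continuous_le.
have L := near_difference_quotient ((df (v + w)).1 x Ux) e30.
have PP := near_parallelogram v w Pn.
have P0 := nbhs_right_gt (0 : R).
have [h [[/= Lh Ph] h0]] := filter_ex (filterI (filterI L PP) P0).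
have h0' : 0 <= h <= h by rewrite ltW // lexx.
have z0' : 0 <= (0 : R) <= h by rewrite lexx ltW.
have [s /and_lt_le sh E1] : exists2 s, 0 < s < h & f (h *: v + (h *: w + x)) - f (h *: w + x)
    = h * 'D_v f (s *: v + (h *: w + x)).
  by apply: mvt_dir => // s sh; have [Us _] := Ph s h sh h0'; exact: (df v).1.
have [s' /and_lt_le sh' E2] : exists2 s, 0 < s < h & f (h *: w + x) - f x
    = h * 'D_w f (s *: w + x).
  apply: mvt_dir => // s' sh'; have [Us _] := Ph 0 s' z0' sh'.
  by move: Us; rewrite scale0r add0r; exact: (df w).1.
have [_ [A1 _]] := Ph s h sh h0'; have [_ [_ A2]] := Ph 0 s' z0' sh'.
move: A2; rewrite /= scale0r add0r => A2.
have E : h^-1 *: (f (h *: (v + w) + x) - f x) =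
    'D_v f (s *: v + (h *: w + x)) + 'D_w f (s' *: w + x).
  rewrite (scalerDr h) -addrA.
  have -> : f (h *: v + (h *: w + x)) - f x =
     h * 'D_v f (s *: v + (h *: w + x)) + h * 'D_w f (s' *: w + x).
    by rewrite -E1 -E2 subrKA.
  by rewrite -mulrDr [LHS]mulKf // gt_eqF.
rewrite E in Lh; move: Lh A1 A2 => /=.
exact: dist_sum_le.
Qed.

(** Two mean value theorems: along [v] for the increment [phi y = f (h w + y) - f y], then along [w]
    for ['D_v f]. The quotient thus equals ['D_w ('D_v f)] at a point of a small parallelogram at
    [x]. *)
Lemma near_second_difference U f x v w e : open U -> Ck 2 U f -> U x -> 0 < e ->
  \forall h \near (0 : R)^'+,
    `|(f (h *: v + (h *: w + x)) - f (h *: v + x) - f (h *: w + x) + f x) / h ^+ 2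
      - 'D_w ('D_v f) x| <= e.
Proof.
move=> oU [cf df] Ux e0.
have nU : nbhs x U by exact: open_nbhs_nbhs.
have [dv [cv dwv]] := df v.
have [dw' [cwv _]] := dwv w.
have Pn : nbhs x (U `&` [set y | `|'D_w ('D_v f) y - 'D_w ('D_v f) x| <= e]).
  by apply: filterI => //; apply: near_continuous_le => //; exact: cwv.
near=> h.
have h0 : 0 < h by near: h; exact: nbhs_right_gt.
have Ph : forall s s', 0 <= s <= h -> 0 <= s' <= h ->
  (U `&` [set y | `|'D_w ('D_v f) y - 'D_w ('D_v f) x| <= e]) (s *: v + (s' *: w + x)).
  by near: h; exact: near_parallelogram.
have h0' : 0 <= h <= h by rewrite ltW // lexx.
have z0' : 0 <= (0 : R) <= h by rewrite lexx ltW.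
pose phi y := f (h *: w + y) - f y.
have dphi (s : R) : 0 <= s <= h -> is_derive (s *: v + x) v phi
    ('D_v f (h *: w + (s *: v + x)) - 'D_v f (s *: v + x)).
  move=> sh; have [U1 _] := Ph s h sh h0'; have [U2 _] := Ph s 0 sh z0'.
  rewrite scale0r add0r in U2.
  have E : forall z k, h *: w + (k *: v + z) = k *: v + (h *: w + z).
    by move=> z k; rewrite addrCA.
  have [E1 E2] := @derive_affine R V V R (fun y => h *: w + y) id f (s *: v + x) v (E _).
  have d1 : derivable (f \o (fun y => h *: w + y)) (s *: v + x) v.
    by apply/E2; apply: dv; rewrite E.
  rewrite -[X in X - _]E1; apply: is_deriveB; last exact/derivableP/dv.
  exact: derivableP.
have [k kh|s /and_lt_le sh E1] := @mvt_dir phi x v h h0.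
  by have [] := dphi k kh.
have E0 k : h *: w + (k *: v + x) = k *: v + (h *: w + x) by rewrite addrCA.
have [k kh|s' /and_lt_le sh' E2] := @mvt_dir ('D_v f) (s *: v + x) w h h0.
  by rewrite addrCA; have [Us _] := Ph s k sh kh; exact: dw'.
have -> : f (h *: v + (h *: w + x)) - f (h *: v + x) - f (h *: w + x) + f x
   = h ^+ 2 * 'D_w ('D_v f) (s' *: w + (s *: v + x)).
  rewrite expr2 -mulrA -E2; have [_ <-] := dphi s sh; rewrite -E1 /phi E0.
  by rewrite -[LHS]addrA opprB [- _ + _]addrC.
rewrite mulrAC mulfV ?mul1r; last by rewrite expf_neq0 // gt_eqF.
rewrite addrCA; exact: (Ph s s' sh sh').2.
Unshelve. all: by end_near. Qed.

(** The second difference is symmetric in [v] and [w], and both mixed derivatives are its limit. *)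
Lemma derive_comm U f x v w : open U -> Ck 2 U f -> U x ->
  'D_v ('D_w f) x = 'D_w ('D_v f) x.
Proof.
move=> oU Cf Ux; apply: eq_of_close => e e0.
have e20 : 0 < e / 2 by rewrite divr_gt0.
have H1 := near_second_difference v w oU Cf Ux e20.
have H2 := near_second_difference w v oU Cf Ux e20.
have [h [/= A B]] := filter_ex (filterI H1 H2).
rewrite [h *: w + (h *: v + x)]addrCA [X in X + f x]addrAC in B.
exact: dist_half_le B A.
Qed.

Lemma derive_at_interior_max U f x v : open U -> (forall y, U y -> derivable f y v) ->
  U x -> (forall y, U y -> f y <= f x) -> 'D_v f x = 0.
Proof.
move=> oU df Ux fx.
have nU : nbhs x U by exact: open_nbhs_nbhs.
have [r /= r0 rP] : exists2 r, 0 < r & forall s, `|s| < r -> U (s *: v + x).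
  have := @continuous_line_pt R V x v 0.
  move=> /(_ U); rewrite /= scale0r add0r => /(_ nU) /nbhs_ballP[r r0 rP].
  by exists r => // s sr; apply: rP; rewrite -ball_normE /ball_ /= sub0r normrN.
have H s : s \in `](- r), r[%R -> `|s| < r by rewrite in_itv /= ltr_norml.
have [_ E] : is_derive (0 : R) (1 : R) (fun s : R => f (s *: v + x)) 0.
  apply: (@derive1_at_max _ _ (- r) r) => [|s sr||s sr].
  - by rewrite ge0_cp // ltW.
  - by have /df/derivableP/is_derive_line[] := rP _ (H s sr).
  - by rewrite in_itv /= oppr_lt0 r0.
  - by rewrite scale0r add0r; apply: fx; apply: rP; exact: H.
by have /df/derivableP/is_derive_line0[_ <-] := Ux.
Qed.

(** If the second derivative were positive at [x], it would be positive nearby. Since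
    ['D_v f x = 0], two mean value theorems would then give [f (h v + x) > f x]. *)
Lemma second_derive_at_interior_max U f x v : open U -> Ck 2 U f ->
  U x -> (forall y, U y -> f y <= f x) -> 'D_v ('D_v f) x <= 0.
Proof.
move=> oU [cf df] Ux fx; rewrite leNgt; apply/negP => D0.
have [dv [cv dvv]] := df v; have [dv' [cvv _]] := dvv v.
have nU : nbhs x U by exact: open_nbhs_nbhs.
have D20 : 0 < 'D_v ('D_v f) x / 2 by rewrite divr_gt0.
have Pn : nbhs x (U `&` [set y | `|'D_v ('D_v f) y - 'D_v ('D_v f) x| <= 'D_v ('D_v f) x / 2]).
  by apply: filterI => //; apply: near_continuous_le => //; exact: cvv.
have P0 := nbhs_right_gt (0 : R).
have [h [/= Ph h0]] := filter_ex (filterI (near_parallelogram v 0 Pn) P0).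
have {}Ph (s : R) : 0 <= s <= h -> U (s *: v + x) /\ 0 < 'D_v ('D_v f) (s *: v + x).
  move=> sh; have := Ph s s sh sh; rewrite scaler0 add0r => -[Us /=].
  move=> A; split; [exact: Us|exact: (pos_of_close D0 A)].
have h0' : 0 <= h <= h by rewrite ltW // lexx.
have D1 := derive_at_interior_max oU dv Ux fx.
have [s /andP[s0 sh] E1] := mvt_dir h0 (fun s sh => dv _ (Ph s sh).1).
have Ph' (k : R) : 0 <= k <= s -> U (k *: v + x) /\ 0 < 'D_v ('D_v f) (k *: v + x).
  by move=> /andP[k0 ks]; apply: Ph; rewrite k0 (le_trans ks) // ltW.
have [k /andP[k0 ks] E2] := mvt_dir s0 (fun s sh => dv' _ (Ph' s sh).1).
have ks' : 0 <= k <= s by rewrite !ltW.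
move: E2; rewrite D1 subr0 => E2.
have P1 : 0 < 'D_v f (s *: v + x) by rewrite E2; exact: (mulr_gt0 s0 (Ph' k ks').2).
have := fx _ (Ph h h0').1; rewrite -subr_le0 E1 leNgt.
by move/negP; apply; exact: (mulr_gt0 h0 P1).
Qed.

End SecondDerivatives.

(** * Smooth functions on the manifold and on spacetime *)

Section SmoothFunctions.
Context {R : realType} {n : nat} {M : topologicalType}.
Variable A : set (chart R n M).
Implicit Types (c : chart R n M) (f g : M -> R) (F G : M -> R -> R).

Definition st_dom c : set ('rV[R]_n * R) := [set z | cimg c z.1 /\ 0 < z.2].

Definition st_chart c F : 'rV[R]_n * R -> R := fun z => F (cinv c z.1) z.2.

(** This is the second half of [spacetime_regular], kept apart because derived quantities such as
    [ln u] and its derivatives are studied only at positive times. *)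
Definition st_smooth F := forall c, A c -> smooth_on (st_dom c) (st_chart c F).

Lemma open_cimg c : open (cimg c). Proof. exact: cimg_open. Qed.

Lemma open_st_dom c : open (st_dom c).
Proof.
have -> : st_dom c = (fst @^-1` cimg c) `&` (snd @^-1` [set t | 0 < t]) by [].
apply: openI; apply: open_comp.
- by move=> z _; exact: cvg_fst.
- exact: open_cimg.
- by move=> z _; exact: cvg_snd.
- exact: open_gt.
Qed.

Lemma cinvK c z : cimg c z -> cdom c (cinv c z) /\ cmap c (cinv c z) = z.
Proof. by move=> [p cp <-]; rewrite cmapK. Qed.

Lemma smooth_cst (k : R) : smooth A (fun=> k).
Proof. by move=> c Ac j; exact: Ck_cst. Qed.

Lemma smoothD f g : smooth A f -> smooth A g -> smooth A (fun p => f p + g p).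
Proof.
move=> sf sg c Ac j; apply: (@Ck_D _ _ _ _ (f \o cinv c) (g \o cinv c)).
- exact: open_cimg.
- exact: sf.
- exact: sg.
Qed.

Lemma smoothM f g : smooth A f -> smooth A g -> smooth A (fun p => f p * g p).
Proof.
move=> sf sg c Ac j; apply: (@Ck_M _ _ _ _ (f \o cinv c) (g \o cinv c)).
- exact: open_cimg.
- exact: sf.
- exact: sg.
Qed.

Lemma smooth_powR f a : (forall p, 0 < f p) -> smooth A f ->
  smooth A (fun p => f p `^ a).
Proof.
move=> f0 sf c Ac j; apply: (@Ck_powR _ _ _ _ (f \o cinv c)).
- exact: open_cimg.
- by move=> z _; exact: f0.
- exact: sf.
Qed.

Lemma smooth_ln f : (forall p, 0 < f p) -> smooth A f -> smooth A (fun p => ln (f p)).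
Proof.
move=> f0 sf c Ac j; apply: (@Ck_ln _ _ _ _ (f \o cinv c)).
- exact: open_cimg.
- by move=> z _; exact: f0.
- exact: sf.
Qed.

Lemma smoothN f : smooth A f -> smooth A (fun p => - f p).
Proof.
move=> sf; have -> : (fun p => - f p) = (fun p => -1 * f p).
  by apply/funext => p; rewrite mulN1r.
by apply: smoothM => //; exact: smooth_cst.
Qed.

Lemma smoothB f g : smooth A f -> smooth A g -> smooth A (fun p => f p - g p).
Proof. by move=> sf sg; apply: smoothD => //; exact: smoothN. Qed.

Lemma smooth_sum (I : Type) (r : seq I) (F : I -> M -> R) :
  (forall i, smooth A (F i)) -> smooth A (fun p => \sum_(i <- r) F i p).
Proof.
move=> sF; elim: r => [|i r IH].
  have -> : (fun p => \sum_(i <- [::]) F i p) = (fun=> 0).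
    by apply/funext => p; rewrite big_nil.
  exact: smooth_cst.
have -> : (fun p => \sum_(j <- i :: r) F j p) = (fun p => F i p + \sum_(j <- r) F j p).
  by apply/funext => p; rewrite big_cons.
exact: smoothD.
Qed.

Lemma st_cst (k : R) : st_smooth (fun _ _ => k).
Proof. by move=> c Ac j; exact: Ck_cst. Qed.

Lemma stD F G : st_smooth F -> st_smooth G -> st_smooth (fun p t => F p t + G p t).
Proof.
move=> sf sg c Ac j; apply: (@Ck_D _ _ _ _ (st_chart c F) (st_chart c G)).
- exact: open_st_dom.
- exact: sf.
- exact: sg.
Qed.

Lemma stM F G : st_smooth F -> st_smooth G -> st_smooth (fun p t => F p t * G p t).
Proof.
move=> sf sg c Ac j; apply: (@Ck_M _ _ _ _ (st_chart c F) (st_chart c G)).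
- exact: open_st_dom.
- exact: sf.
- exact: sg.
Qed.

Lemma st_sum (I : Type) (r : seq I) (P : pred I) (F : I -> M -> R -> R) :
  (forall i, P i -> st_smooth (F i)) ->
  st_smooth (fun p t => \sum_(i <- r | P i) F i p t).
Proof.
move=> sF c Ac j; apply: (@Ck_sum _ _ _ _ _ r P (fun i => st_chart c (F i))).
- exact: open_st_dom.
- by move=> i Pi; exact: sF.
Qed.

Lemma st_powR F a : (forall p t, 0 < t -> 0 < F p t) -> st_smooth F ->
  st_smooth (fun p t => F p t `^ a).
Proof.
move=> f0 sf c Ac j; apply: (@Ck_powR _ _ _ _ (st_chart c F)).
- exact: open_st_dom.
- by move=> z [_ z0]; exact: f0.
- exact: sf.
Qed.

Lemma st_ln F : (forall p t, 0 < t -> 0 < F p t) -> st_smooth F ->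
  st_smooth (fun p t => ln (F p t)).
Proof.
move=> f0 sf c Ac j; apply: (@Ck_ln _ _ _ _ (st_chart c F)).
- exact: open_st_dom.
- by move=> z [_ z0]; exact: f0.
- exact: sf.
Qed.

Lemma st_lift f : smooth A f -> st_smooth (fun p _ => f p).
Proof.
move=> sf c Ac j.
apply: (@Ck_affine R _ _ fst fst _ (cimg c) _ (f \o cinv c)) => //.
- exact: open_st_dom.
- by move=> z; exact: cvg_fst.
- by move=> z [].
- exact: sf.
Qed.

Lemma slice_affine (t h : R) (v z : 'rV[R]_n) :
  (h *: v + z, t) = h *: (v, 0 : R) + (z, t).
Proof. by congr pair; rewrite /= scaler0 add0r. Qed.

Lemma time_affine (x : 'rV[R]_n) (h s t : R) :
  (x, h *: s + t) = h *: ((0 : 'rV[R]_n), s) + (x, t).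
Proof. by congr pair; rewrite /= scaler0 add0r. Qed.

Lemma st_slice F t : st_smooth F -> 0 < t -> smooth A (F ^~ t).
Proof.
move=> sF t0 c Ac j.
apply: (@Ck_affine R _ _ (fun x => (x, t)) (fun v => (v, 0)) _ (st_dom c) _ (st_chart c F)).
- exact: open_cimg.
- move=> z; exact: (@cvg_pair _ _ _ (nbhs z) (nbhs z) (nbhs t) _ _ _ id (cst t) cvg_id (cvg_cst t)).
- by move=> h v z; exact: slice_affine.
- by move=> z cz; split.
- exact: sF.
Qed.

Lemma derive_slice c F t (x v : 'rV[R]_n) :
  'D_v ((F ^~ t) \o cinv c) x = 'D_(v, 0) (st_chart c F) (x, t).
Proof.
exact: (@derive_affine R ('rV[R]_n * R)%type 'rV[R]_n R (fun x => (x, t)) (fun v => (v, 0)) (st_chart c F) x v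
  (fun h => slice_affine t h v x)).1.
Qed.

Lemma derive1_st_chart c F t p : cdom c p ->
  derive1 (F p) t = 'D_(0, 1) (st_chart c F) (cmap c p, t).
Proof.
move=> cp; rewrite derive1E.
have <- := (@derive_affine R ('rV[R]_n * R)%type R R (fun s => (cmap c p, s)) (fun s => (0, s)) (st_chart c F) t 1
  (fun h => time_affine (cmap c p) h 1 t)).1.
by have -> : st_chart c F \o (fun s => (cmap c p, s)) = F p
  by apply/funext => s; rewrite /st_chart /= cmapK.
Qed.

Lemma st_derivable_time F p t : smooth_atlas A -> st_smooth F -> 0 < t ->
  derivable (F p) t 1.
Proof.
move=> [cov _] sF t0; have [c Ac cp] := cov p.
have := (@derive_affine R ('rV[R]_n * R)%type R R (fun s => (cmap c p, s)) (fun s => (0, s)) (st_chart c F) t 1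
  (fun h => time_affine (cmap c p) h 1 t)).2.
have -> : st_chart c F \o (fun s => (cmap c p, s)) = F p.
  by apply/funext => s; rewrite /st_chart /= cmapK.
move=> E; apply/E.
have [_ /(_ (0, 1))[d _]] := sF c Ac 1.
by apply: d; split => //=; exists p.
Qed.

Lemma st_dt F : st_smooth F -> st_smooth (fun p t => derive1 (F p) t).
Proof.
move=> sF c Ac j.
apply: (@Ck_ext _ _ _ _ _ ('D_(0, 1) (st_chart c F))).
- exact: open_st_dom.
- move=> [x t] [/= cx t0]; have [cp E] := cinvK cx.
  by rewrite /st_chart /= (derive1_st_chart _ _ cp) E.
- by have [_ /(_ (0, 1))[]] := sF c Ac j.+1.
Qed.

End SmoothFunctions.

(** * Vector fields acting on spacetime functions *)

Section VectorFields.
Context {R : realType} {n : nat} {M : topologicalType}.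
Variable A : set (chart R n M).
Hypothesis atlasA : smooth_atlas A.
Variable X : (M -> R) -> (M -> R).
Hypothesis vfX : vector_field A X.
Implicit Types (c : chart R n M) (f g : M -> R) (F G : M -> R -> R).

Lemma st_act_chart c : A c -> exists2 b : 'rV[R]_n -> 'rV[R]_n,
  smooth_on (cimg c) b & forall F, st_smooth A F -> forall x t, cimg c x -> 0 < t ->
    X (F ^~ t) (cinv c x) = \sum_(i < n) b x 0 i * 'D_(delta_mx 0 i, 0) (st_chart c F) (x, t).
Proof.
move=> Ac; have [b sb bX] := vfX Ac; exists b => // F sF x t cx t0.
have [cp E] := cinvK cx.
rewrite (bX _ (st_slice sF t0) _ cp) E; apply: eq_bigr => i _.
by rewrite derive_slice.
Qed.

Lemma st_act F : st_smooth A F -> st_smooth A (fun p t => X (F ^~ t) p).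
Proof.
move=> sF c Ac j; have [b sb bX] := st_act_chart Ac.
apply: (@Ck_ext _ _ _ _ _ (fun z => \sum_(i < n)
   b z.1 0 i * 'D_(delta_mx 0 i, 0) (st_chart c F) z)).
- exact: open_st_dom.
- by move=> [x t] [/= cx t0]; rewrite /st_chart /= bX.
- apply: Ck_sum => [|i _]; first exact: open_st_dom.
  apply: Ck_M; first exact: open_st_dom.
  + apply: (@Ck_affine R _ _ fst fst _ (cimg c) _ (fun x => b x 0 i)) => //.
    * exact: open_st_dom.
    * by move=> z; exact: cvg_fst.
    * by move=> z [].
    * by apply: Ck_coord; [exact: open_cimg|exact: sb].
  + by have [_ /(_ (delta_mx 0 i, 0))[]] := sF c Ac j.+1.
Qed.

(** A function on [M] is regarded as constant in time, acted on there, and sliced at an arbitrary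
    positive time, here [1]. *)
Lemma smooth_act f : smooth A f -> smooth A (X f).
Proof. by move=> /st_lift/st_act/(@st_slice _ _ _ _ _ 1); apply. Qed.

(** In a chart the components of [X] do not depend on time, so the claim reduces to the symmetry of
    the mixed derivatives in the directions [(0, 1)] and [(delta_mx 0 i, 0)]. *)
Lemma dt_act F p t : st_smooth A F -> 0 < t ->
  derive1 (fun s => X (F ^~ s) p) t = X (fun q => derive1 (F q) t) p.
Proof.
move=> sF t0; have [c Ac cp] := atlasA.1 p.
have [b sb bX] := st_act_chart Ac.
have cx : cimg c (cmap c p) by exists p.
have := bX _ (st_dt sF) _ _ cx t0; rewrite cmapK // => ->.
pose g i s := 'D_(delta_mx 0 i, 0) (st_chart c F) (cmap c p, s).
have oU := @open_st_dom R n M c.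
have Uz : st_dom c (cmap c p, t) by split.
have D i : is_derive t (1 : R) (g i) ('D_(delta_mx 0 i, 0) (st_chart c (fun p t => derive1 (F p) t)) (cmap c p, t)).
  have [_ /(_ (delta_mx 0 i, 0))[_ [_ /(_ (0, 1))[d _]]]] := sF c Ac 2.
  have [E1 E2] := @derive_affine R ('rV[R]_n * R)%type R R (fun s => (cmap c p, s)) (fun s => (0, s))
    ('D_(delta_mx 0 i, 0) (st_chart c F)) t 1 (fun h => time_affine (cmap c p) h 1 t).
  split; first by apply/E2; exact: d.
  rewrite [LHS]E1 (derive_comm _ _ oU (sF c Ac 2) Uz).
  apply: near_eq_derive; apply: near_open_eq oU Uz _ => -[x s] [/= cy s0].
  have [cq E] := cinvK cy.
  by rewrite /st_chart /= (derive1_st_chart _ _ cq) E.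
have DS : is_derive t (1 : R) (\sum_(i < n) (b (cmap c p) 0 i *: g i))
   (\sum_(i < n) (b (cmap c p) 0 i *: 'D_(delta_mx 0 i, 0) (st_chart c (fun p t => derive1 (F p) t)) (cmap c p, t))).
  by apply: is_derive_sum => i; apply: is_deriveZ.
have [_ <-] : is_derive t (1 : R) (fun s => X (F ^~ s) p)
   (\sum_(i < n) (b (cmap c p) 0 i *: 'D_(delta_mx 0 i, 0) (st_chart c (fun p t => derive1 (F p) t)) (cmap c p, t))).
  apply: near_eq_is_derive DS; apply: (near_open_eq (@open_gt R 0) t0) => s s0.
  by have := bX _ sF _ _ cx s0; rewrite cmapK // fct_sumE => ->.
by rewrite derive1E.
Qed.

End VectorFields.

Lemma scale_regularE (R : realType) (a b : R) : a *: b = a * b.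
Proof. by []. Qed.

(** * Linearity of the derivative in its direction *)

Section DerivativesInCoordinates.
Context {R : realType} {V : normedModType R}.

Lemma derive_scaledir (f : V -> R) x v (k : R) : derivable f x v ->
  'D_(k *: v) f x = k * 'D_v f x.
Proof.
move=> /derivableP/is_derive_line0 df.
have dk : is_derive (0 : R) (1 : R) (fun h : R => h * k) k.
  have -> : (fun h : R => h * k) = k \*: id by apply/funext => h; rewrite /= mulrC.
  have := is_deriveZ k (is_derive_id (0 : R) (1 : R)).
  by rewrite [k *: 1]mulr1.
rewrite -(mul0r k) in df.
have := @is_derive1_comp R (fun h => f (h *: v + x)) (fun h => h * k) 0 _ _ df dk.
have -> : (fun h : R => f (h *: v + x)) \o (fun h : R => h * k)
  = (fun h : R => f (h *: (k *: v) + x)) by apply/funext => h /=; rewrite scalerA.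
by move=> dfk; have [_ ->] := (is_derive_line0 f x (k *: v) _).2 dfk; rewrite mulrC.
Qed.

Lemma derive_sumdir (I : Type) (r : seq I) (k : I -> R) (w : I -> V) U (f : V -> R) x :
  open U -> Ck 1 U f -> U x ->
  'D_(\sum_(i <- r) k i *: w i) f x = \sum_(i <- r) k i * 'D_(w i) f x.
Proof.
move=> oU Cf Ux; elim: r => [|i r IH]; first by rewrite !big_nil derive0.
rewrite !big_cons (deriveDdir _ _ oU Cf Ux) IH derive_scaledir //.
by have [_ /(_ (w i))[d _]] := Cf; exact: d.
Qed.

End DerivativesInCoordinates.

Lemma derive_row (R : realType) n (U : set 'rV[R]_n) (f : 'rV[R]_n -> R) x v :
  open U -> Ck 1 U f -> U x ->
  'D_v f x = \sum_(i < n) v 0 i * 'D_(delta_mx 0 i) f x.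
Proof.
by move=> oU Cf Ux; rewrite {1}(row_sum_delta v); exact: derive_sumdir oU Cf Ux.
Qed.

(** * Derivations of the algebra of smooth functions *)

Section Derivations.
Context {R : realType} {n : nat} {M : topologicalType}.
Variable A : set (chart R n M).
Implicit Types (f g : M -> R).

(** A coordinate-free substitute for [vector_field] that is stable under brackets. The rules for
    powers and logarithms are included because they do not follow formally from the Leibniz rule;
    vector fields get them from charts, brackets by algebra. *)
Record derivation (X : (M -> R) -> (M -> R)) : Prop := Derivation {
  der_smooth : forall f, smooth A f -> smooth A (X f);
  derD : forall f g p, smooth A f -> smooth A g ->
    X (fun q => f q + g q) p = X f p + X g p;
  derM : forall f g p, smooth A f -> smooth A g ->
    X (fun q => f q * g q) p = X f p * g p + f p * X g p;
  der_cst : forall k p, X (fun=> k) p = 0;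
  der_powR : forall f a p, smooth A f -> (forall q, 0 < f q) ->
    X (fun q => f q `^ a) p = a * f p `^ (a - 1) * X f p;
  der_ln : forall f p, smooth A f -> (forall q, 0 < f q) ->
    X (fun q => ln (f q)) p = (f p)^-1 * X f p }.

Lemma vector_field_derivation X : smooth_atlas A -> vector_field A X ->
  derivation X.
Proof.
move=> [cov _] vfX.
have D c f p i : A c -> cdom c p -> smooth A f ->
    is_derive (cmap c p) (delta_mx 0 i) (f \o cinv c)
      ('D_(delta_mx 0 i) (f \o cinv c) (cmap c p)).
  move=> Ac cp sf; apply: derivableP.
  by have [_ /(_ (delta_mx 0 i))[d _]] := sf c Ac 1%N; apply: d; exists p.
split.
- by move=> f; exact: smooth_act.
- move=> f g p sf sg; have [c Ac cp] := cov p; have [b _ bX] := vfX c Ac.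
  rewrite !bX //; last exact: smoothD.
  rewrite -big_split /=; apply: eq_bigr => i _; rewrite -mulrDr; congr (_ * _).
  by have [_ <-] := is_deriveD (D c f p i Ac cp sf) (D c g p i Ac cp sg).
- move=> f g p sf sg; have [c Ac cp] := cov p; have [b _ bX] := vfX c Ac.
  rewrite !bX //; last exact: smoothM.
  rewrite mulr_suml mulr_sumr -big_split /=; apply: eq_bigr => i _.
  have [_ E] := is_deriveM (D c f p i Ac cp sf) (D c g p i Ac cp sg).
  rewrite [X in _ * X = _]E /= cmapK // !scale_regularE.
  ring.
- move=> k p; have [c Ac cp] := cov p; have [b _ bX] := vfX c Ac.
  rewrite bX //; last exact: smooth_cst.
  by rewrite big1 // => i _; rewrite [X in _ * X]derive_cst mulr0.
- move=> f a p sf f0; have [c Ac cp] := cov p; have [b _ bX] := vfX c Ac.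
  rewrite !bX //; last exact: smooth_powR.
  rewrite mulr_sumr; apply: eq_bigr => i _.
  have [_ E] := is_derive_comp_dir (@is_derive1_powR R a ((f \o cinv c) (cmap c p)) (f0 _)) (D c f p i Ac cp sf).
  by rewrite [X in _ * X = _]E /= cmapK // mulrCA.
- move=> f p sf f0; have [c Ac cp] := cov p; have [b _ bX] := vfX c Ac.
  rewrite !bX //; last exact: smooth_ln.
  rewrite mulr_sumr; apply: eq_bigr => i _.
  have [_ E] := is_derive_comp_dir (@is_derive1_ln R ((f \o cinv c) (cmap c p)) (f0 _)) (D c f p i Ac cp sf).
  by rewrite [X in _ * X = _]E /= cmapK // mulrCA.
Qed.

Lemma derZ X k f p : derivation X -> smooth A f -> X (fun q => k * f q) p = k * X f p.
Proof.
by move=> dX sf; rewrite (derM dX p (@smooth_cst _ _ _ A k) sf) (der_cst dX) mul0r add0r.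
Qed.

Lemma operator_ext (X : (M -> R) -> (M -> R)) f g p :
  (forall q, f q = g q) -> X f p = X g p.
Proof. by move=> /funext ->. Qed.

Lemma derN X f p : derivation X -> smooth A f -> X (fun q => - f q) p = - X f p.
Proof.
move=> dX sf; rewrite (@operator_ext _ _ (fun q => -1 * f q)) ?derZ ?mulN1r //.
by move=> q; rewrite mulN1r.
Qed.

Lemma derB X f g p : derivation X -> smooth A f -> smooth A g ->
  X (fun q => f q - g q) p = X f p - X g p.
Proof. by move=> dX sf sg; rewrite (derD dX) ?derN //; exact: smoothN. Qed.

Lemma der_sum X (I : Type) (r : seq I) (F : I -> M -> R) p : derivation X ->
  (forall i, smooth A (F i)) ->
  X (fun q => \sum_(i <- r) F i q) p = \sum_(i <- r) X (F i) p.
Proof.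
move=> dX sF; elim: r => [|i r IH].
  rewrite (@operator_ext _ _ (fun=> 0)) ?(der_cst dX) ?big_nil // => q.
  by rewrite big_nil.
rewrite (@operator_ext _ _ (fun q => F i q + \sum_(j <- r) F j q)); last first.
  by move=> q; rewrite big_cons.
by rewrite (derD dX) ?IH ?big_cons //; exact: smooth_sum.
Qed.

Lemma der_sqr X f p : derivation X -> smooth A f ->
  X (fun q => f q ^+ 2) p = 2 * f p * X f p.
Proof. by move=> dX sf; rewrite (derM dX) //; ring. Qed.

(** In every rule the terms containing both a derivative by [X] and one by [Y] as separate factors
    are symmetric in [X] and [Y], hence cancel in the bracket. *)
Lemma bracket_derivation X Y : derivation X -> derivation Y -> derivation (bracket X Y).
Proof.
move=> dX dY.
have sX f : smooth A f -> smooth A (X f) by exact: der_smooth.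
have sY f : smooth A f -> smooth A (Y f) by exact: der_smooth.
split; rewrite /bracket.
- by move=> f sf; apply: smoothB; [apply: sX; exact: sY|apply: sY; exact: sX].
- move=> f g p sf sg.
  have sXf := sX f sf; have sXg := sX g sg; have sYf := sY f sf; have sYg := sY g sg.
  rewrite (@operator_ext X _ _ p (fun q => derD dY q sf sg)).
  rewrite (@operator_ext Y _ _ p (fun q => derD dX q sf sg)).
  by rewrite (derD dX) ?(derD dY) // opprD addrACA.
- move=> f g p sf sg.
  have sXf := sX f sf; have sXg := sX g sg; have sYf := sY f sf; have sYg := sY g sg.
  rewrite (@operator_ext X _ _ p (fun q => derM dY q sf sg)).
  rewrite (@operator_ext Y _ _ p (fun q => derM dX q sf sg)).
  rewrite (derD dX) ?(derD dY) ?(derM dX) ?(derM dY) //; try exact: smoothM.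
  ring.
- move=> k p.
  rewrite (@operator_ext X _ _ p (der_cst dY k)) (@operator_ext Y _ _ p (der_cst dX k)).
  by rewrite (der_cst dX) (der_cst dY) subr0.
- move=> f a p sf f0.
  have sXf := sX f sf; have sYf := sY f sf.
  have sp b : smooth A (fun q => f q `^ b) by exact: smooth_powR.
  have spa b : smooth A (fun q => a * f q `^ b) by apply: smoothM => //; exact: smooth_cst.
  rewrite (@operator_ext X _ _ p (fun q => der_powR dY a q sf f0)).
  rewrite (@operator_ext Y _ _ p (fun q => der_powR dX a q sf f0)).
  rewrite (derM dX) // (derM dY) // !(derZ a) // (der_powR dX) // (der_powR dY) //.
  ring.
- move=> f p sf f0.
  have sXf := sX f sf; have sYf := sY f sf.
  have sp : smooth A (fun q => (f q)^-1).
    have -> : (fun q => (f q)^-1) = (fun q => f q `^ (-1)).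
      by apply/funext => q; rewrite powR_inv1 // ltW.
    exact: smooth_powR.
  have der_inv Z : derivation Z -> Z (fun q => (f q)^-1) p = - (f p `^ (-1 - 1) * Z f p).
    move=> dZ; rewrite (@operator_ext Z _ (fun q => f q `^ (-1))).
      by rewrite (der_powR dZ) // mulN1r mulNr.
    by move=> q; rewrite powR_inv1 // ltW.
  rewrite (@operator_ext X _ _ p (fun q => der_ln dY q sf f0)).
  rewrite (@operator_ext Y _ _ p (fun q => der_ln dX q sf f0)).
  rewrite (derM dX) // (derM dY) // !der_inv //.
  ring.
Qed.

Lemma derivation_Y' d (e : 'I_d -> (M -> R) -> (M -> R)) q :
  (forall j, derivation (e j)) -> derivation (Y' e q).
Proof. by case: q => i j de; exact: bracket_derivation. Qed.

Lemma derivation_Y'' d (e : 'I_d -> (M -> R) -> (M -> R)) q :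
  (forall j, derivation (e j)) -> derivation (Y'' e q).
Proof. by case: q => -[i j] k de; do 2!apply: bracket_derivation => //. Qed.

Lemma derivation_Y d (e : 'I_d -> (M -> R) -> (M -> R)) al :
  (forall j, derivation (e j)) -> derivation (Y e al).
Proof. by case: al => q de; [exact: derivation_Y'|exact: derivation_Y'']. Qed.

End Derivations.

(** * Vector fields at a maximum, and continuity *)

Section MaximumAndContinuity.
Context {R : realType} {n : nat} {M : topologicalType}.
Variable A : set (chart R n M).
Hypothesis atlasA : smooth_atlas A.
Implicit Types (f g : M -> R).

Lemma vector_field_at_max X f p : vector_field A X -> smooth A f ->
  (forall q, f q <= f p) -> X f p = 0 /\ X (X f) p <= 0.
Proof.
move=> vfX sf fp; have [c Ac cp] := atlasA.1 p.
have [b sb bX] := vfX c Ac.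
have oU := @open_cimg R n M c.
have Up : cimg c (cmap c p) by exists p.
pose ft := f \o cinv c.
have Cf k : Ck k (cimg c) ft by exact: sf.
have E y : cimg c y -> X f (cinv c y) = \sum_(i < n) b y 0 i * 'D_(delta_mx 0 i) ft y.
  by move=> cy; have [cq Eq] := cinvK cy; rewrite (bX _ sf _ cq) Eq.
have fmax y : cimg c y -> ft y <= ft (cmap c p) by move=> _; rewrite /ft /= cmapK.
have D0 v : 'D_v ft (cmap c p) = 0.
  apply: derive_at_interior_max oU _ Up fmax => y Uy.
  by have [_ /(_ v)[d _]] := Cf 1%N; exact: d.
split; first by rewrite -(cmapK cp) E // big1 // => i _; rewrite D0 mulr0.
rewrite (bX _ (smooth_act vfX sf) _ cp).
set x := cmap c p; set v := b x.
have -> : \sum_(i < n) v 0 i * 'D_(delta_mx 0 i) (X f \o cinv c) x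
   = 'D_v ('D_v ft) x.
  have C1 : Ck 1 (cimg c) (X f \o cinv c) by exact: (smooth_act vfX sf).
  rewrite -(derive_row v oU C1 Up) -/x.
  have Cb i : Ck 1 (cimg c) (fun y => b y 0 i) by apply: Ck_coord => //; exact: sb.
  have CD i : Ck 1 (cimg c) ('D_(delta_mx 0 i) ft).
    by have [_ /(_ (delta_mx 0 i))[]] := Cf 2%N.
  have CDv : Ck 1 (cimg c) ('D_v ft) by have [_ /(_ v)[]] := Cf 2%N.
  have P1 i : is_derive x v (fun y => b y 0 i * 'D_(delta_mx 0 i) ft y)
      (b x 0 i *: 'D_v ('D_(delta_mx 0 i) ft) x).
    apply: is_derive_eq (is_deriveM (CkS_derive v (Cb i) Up) (CkS_derive v (CD i) Up)) _.
    by rewrite D0 scale0r addr0.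
  have P2 i : is_derive x v (fun y => v 0 i * 'D_(delta_mx 0 i) ft y)
      (b x 0 i *: 'D_v ('D_(delta_mx 0 i) ft) x).
    exact: (is_deriveZ (v 0 i) (CkS_derive v (CD i) Up)).
  have S1 := is_derive_sum P1; have S2 := is_derive_sum P2.
  have [_ ->] : is_derive x v ('D_v ft) (\sum_(i < n) b x 0 i *: 'D_v ('D_(delta_mx 0 i) ft) x).
    apply: near_eq_is_derive S2; apply: (near_open_eq oU Up) => y Uy.
    by rewrite fct_sumE -(derive_row v oU (Cf 1%N) Uy).
  have Q : is_derive x v (X f \o cinv c) (\sum_(i < n) b x 0 i *: 'D_v ('D_(delta_mx 0 i) ft) x).
    apply: near_eq_is_derive S1; apply: (near_open_eq oU Up) => y Uy.
    by rewrite fct_sumE; exact: (esym (E y Uy)).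
  by have [_ ->] := Q.
exact: second_derive_at_interior_max oU (Cf 2%N) Up fmax.
Qed.

Lemma cmap_continuous_at c p : cdom c p -> {for p, continuous (cmap c : M -> 'rV[R]_n)}.
Proof.
move=> cp; have := @cmap_continuous R n M c.
rewrite continuous_open_subspace; last exact: cdom_open.
by apply; rewrite inE.
Qed.

Lemma smooth_continuous f : smooth A f -> continuous f.
Proof.
move=> sf p; have [c Ac cp] := atlasA.1 p.
apply: (@continuous_open_ext _ _ (cdom c) ((f \o cinv c) \o cmap c)) => //.
- exact: cdom_open.
- by move=> q cq; rewrite /= cmapK.
- apply: continuous_comp; first exact: cmap_continuous_at.
  by have [cf _] := sf c Ac 0%N; apply: cf; exists p.
Qed.

Lemma st_continuous F p t : st_smooth A F -> 0 < t ->
  {for (p, t), continuous (fun z : M * R => F z.1 z.2)}.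
Proof.
move=> sF t0; have [c Ac cp] := atlasA.1 p.
apply: (@continuous_open_ext _ _ (fst @^-1` cdom c)
   (st_chart c F \o (fun z : M * R => (cmap c z.1, z.2)))) => //.
- by apply: open_comp; [move=> z _; exact: cvg_fst|exact: cdom_open].
- by move=> [q s] /= cq; rewrite /st_chart /= cmapK.
- apply: continuous_comp; last first.
    by have [cf _] := sF c Ac 0%N; apply: cf; split => //=; exists p.
  have c1 : (fun z : M * R => cmap c z.1) @ (p, t) --> cmap c p.
    exact: (cvg_comp _ _ (@cvg_fst _ _ (nbhs p) (nbhs t) _) (cmap_continuous_at cp)).
  exact: (cvg_pair c1 (@cvg_snd _ _ (nbhs p) (nbhs t) _)).
Qed.

End MaximumAndContinuity.

(** * Bochner identities and the evolution of the Harnack quantity at a fixed time *)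

Section Evolution.
Context {R : realType} {n d : nat} {M : topologicalType}.
Variables (A : set (chart R n M)) (e : 'I_d -> (M -> R) -> (M -> R)).
Hypothesis de : forall j, derivation A (e j).
Implicit Types (f g v : M -> R) (p : M).

(** The spatial part of [cL]. The time derivative is subtracted separately, since [f] and [g] are
    slices at one time. *)
Definition drift_laplacian f g : M -> R :=
  fun p => L e g p + 2 * \sum_(j < d) e j f p * e j g p.

Let se j f : smooth A f -> smooth A (e j f). Proof. exact: der_smooth. Qed.
Let see j f : smooth A f -> smooth A (e j (e j f)).
Proof. by move=> sf; apply: se; exact: se. Qed.

Lemma smooth_L f : smooth A f -> smooth A (L e f).
Proof. by move=> sf; apply: smooth_sum => j; exact: see. Qed.

Lemma smooth_sqr f : smooth A f -> smooth A (fun p => f p ^+ 2).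
Proof. by move=> sf; exact: smoothM. Qed.

Lemma GammaE f p : Gamma e f p = \sum_(j < d) e j f p ^+ 2.
Proof. by apply: eq_bigr => j _; rewrite real_normK ?num_real. Qed.

Lemma GammaZE f p : GammaZ e f p = \sum_al Y e al f p ^+ 2.
Proof. by apply: eq_bigr => j _; rewrite real_normK ?num_real. Qed.

Lemma smooth_Gamma f : smooth A f -> smooth A (Gamma e f).
Proof.
move=> sf; have -> : Gamma e f = fun p => \sum_(j < d) e j f p ^+ 2.
  by apply/funext => p; exact: GammaE.
by apply: smooth_sum => j; apply: smooth_sqr; exact: se.
Qed.

Lemma der_Gamma X f p : derivation A X -> smooth A f ->
  X (Gamma e f) p = 2 * \sum_(j < d) e j f p * X (e j f) p.
Proof.
move=> dX sf; rewrite (@operator_ext _ _ X _ _ p (GammaE f)) (der_sum _ _ dX); last first.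
  by move=> j; apply: smooth_sqr; exact: se.
by rewrite mulr_sumr; apply: eq_bigr => j _; rewrite (der_sqr _ dX) ?mulrA //; exact: se.
Qed.

Lemma LD f g p : smooth A f -> smooth A g ->
  L e (fun q => f q + g q) p = L e f p + L e g p.
Proof.
move=> sf sg; rewrite /L -big_split /=; apply: eq_bigr => j _.
by rewrite (@operator_ext _ _ (e j) _ _ p (fun q => derD (de j) q sf sg)) (derD (de j)) //; exact: se.
Qed.

Lemma LZ k f p : smooth A f -> L e (fun q => k * f q) p = k * L e f p.
Proof.
move=> sf; rewrite /L mulr_sumr; apply: eq_bigr => j _.
by rewrite (@operator_ext _ _ (e j) _ _ p (fun q => derZ k q (de j) sf)) (derZ _ _ (de j)) //; exact: se.
Qed.

Lemma L_sum (I : Type) (r : seq I) (F : I -> M -> R) p : (forall i, smooth A (F i)) ->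
  L e (fun q => \sum_(i <- r) F i q) p = \sum_(i <- r) L e (F i) p.
Proof.
move=> sF; rewrite /L [RHS]exchange_big /=; apply: eq_bigr => j _.
rewrite (@operator_ext _ _ (e j) _ _ p (fun q => der_sum r q (de j) sF)).
by rewrite (der_sum _ _ (de j)) // => i; exact: se.
Qed.

Lemma L_sqr g p : smooth A g ->
  L e (fun q => g q ^+ 2) p = 2 * \sum_(j < d) e j g p ^+ 2 + 2 * g p * L e g p.
Proof.
move=> sg; rewrite /L mulr_sumr [X in _ = _ + X]mulr_sumr -big_split /=; apply: eq_bigr => j _.
have E q : e j (fun q => g q ^+ 2) q = 2 * (g q * e j g q).
  by rewrite (der_sqr _ (de j)) // mulrA.
have sg' := se j sg.
rewrite (@operator_ext _ _ (e j) _ _ p E) (derZ _ _ (de j)); last exact: smoothM.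
by rewrite (derM (de j)) //; ring.
Qed.

Lemma drift_laplacianD f g g' p : smooth A g -> smooth A g' ->
  drift_laplacian f (fun q => g q + g' q) p = drift_laplacian f g p + drift_laplacian f g' p.
Proof.
move=> sg sg'; rewrite /drift_laplacian LD // addrACA -mulrDr; congr (_ + 2 * _).
by rewrite -big_split; apply: eq_bigr => j _; rewrite (derD (de j)) // mulrDr.
Qed.

Lemma drift_laplacianZ f k g p : smooth A g ->
  drift_laplacian f (fun q => k * g q) p = k * drift_laplacian f g p.
Proof.
move=> sg; rewrite /drift_laplacian LZ // mulrDr mulrCA; congr (_ + 2 * _).
by rewrite mulr_sumr; apply: eq_bigr => j _; rewrite (derZ _ _ (de j)) // mulrCA.
Qed.

Lemma drift_laplacian_sum f (I : Type) (r : seq I) (F : I -> M -> R) p :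
  (forall i, smooth A (F i)) ->
  drift_laplacian f (fun q => \sum_(i <- r) F i q) p = \sum_(i <- r) drift_laplacian f (F i) p.
Proof.
move=> sF; rewrite /drift_laplacian L_sum // big_split /= -mulr_sumr; congr (_ + 2 * _).
rewrite exchange_big /=; apply: eq_bigr => j _.
by rewrite (der_sum _ _ (de j)) // mulr_sumr.
Qed.

(** Bochner's identity, from [L (g^2) = 2 sum (e_j g)^2 + 2 g L g] with [g = e_i f]. What is left of
    the curvature is the commutator of [L] with [e_i]. *)
Lemma Gamma2E f p : smooth A f ->
  Gamma2 e f p = \sum_(i < d) \sum_(j < d) e j (e i f) p ^+ 2
    + \sum_(i < d) e i f p * (L e (e i f) p - e i (L e f) p).
Proof.
move=> sf; rewrite /Gamma2.
have -> : L e (Gamma e f) p = L e (fun q => \sum_(i < d) e i f q ^+ 2) p.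
  by apply: operator_ext => q; exact: GammaE.
rewrite L_sum; last by move=> i; apply: smooth_sqr; exact: se.
rewrite (eq_bigr (fun i => 2 * \sum_(j < d) e j (e i f) p ^+ 2 + 2 * (e i f p * L e (e i f) p))).
  rewrite big_split /= -!mulr_sumr -addrA -mulrBr -mulrDr mulKf //; congr (_ + _).
  by rewrite -sumrB; apply: eq_bigr => i _; rewrite mulrBr.
by move=> i _; rewrite L_sqr ?mulrA //; exact: se.
Qed.

Lemma Gamma2ZE f p : smooth A f ->
  Gamma2Z e f p = \sum_al \sum_(j < d) e j (Y e al f) p ^+ 2
    + \sum_al Y e al f p * (L e (Y e al f) p - Y e al (L e f) p).
Proof.
move=> sf; rewrite /Gamma2Z.
have sY al : smooth A (Y e al f) by apply: der_smooth => //; exact: derivation_Y.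
have -> : L e (GammaZ e f) p = L e (fun q => \sum_al Y e al f q ^+ 2) p.
  by apply: operator_ext => q; exact: GammaZE.
rewrite L_sum; last by move=> i; exact: smooth_sqr.
rewrite (eq_bigr (fun al => 2 * \sum_(j < d) e j (Y e al f) p ^+ 2
    + 2 * (Y e al f p * L e (Y e al f) p))).
  rewrite big_split /= -!mulr_sumr -addrA -mulrBr -mulrDr mulKf //; congr (_ + _).
  by rewrite -sumrB; apply: eq_bigr => i _; rewrite mulrBr.
by move=> i _; rewrite L_sqr ?mulrA.
Qed.

(* [v] stands for the time derivative of [f = ln u] at a fixed time. *)
Section LogHeat.
Variables f v : M -> R.
Hypotheses (sf : smooth A f) (sv : smooth A v).
Hypothesis vE : forall p, v p = L e f p + Gamma e f p.

Lemma der_v X p : derivation A X ->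
  X v p = X (L e f) p + 2 * \sum_(j < d) e j f p * X (e j f) p.
Proof.
move=> dX; rewrite (@operator_ext _ _ X _ _ p vE) (derD dX) ?(der_Gamma _ dX) //.
- exact: smooth_L.
- exact: smooth_Gamma.
Qed.

(** The drift in [cL] is designed for this cancellation: [e_j v] contains [e_j (Gamma e f)], which
    removes the first-order term of [drift_laplacian f (Gamma e f)]. *)
Lemma Gamma_evolution p :
  drift_laplacian f (Gamma e f) p - 2 * \sum_(j < d) e j f p * e j v p
  = 2 * Gamma2 e f p.
Proof.
rewrite /drift_laplacian /Gamma2 mulVKf //.
rewrite -addrA -mulrBr; congr (_ + _); rewrite -mulrN; congr (2 * _).
rewrite -sumrB -sumrN; apply: eq_bigr => j _; rewrite (der_v _ (de j)) (der_Gamma _ (de j)) //; ring.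
Qed.

(** Only commutators with [X] survive: that of [L], and those of the [e_j] coming from the drift. *)
Lemma der_evolution X p : derivation A X ->
  drift_laplacian f (X f) p - X v p
  = L e (X f) p - X (L e f) p + 2 * \sum_(j < d) e j f p * bracket (e j) X f p.
Proof.
move=> dX; rewrite /drift_laplacian (der_v _ dX) opprD addrACA -mulrBr; congr (_ + 2 * _).
by rewrite -sumrB; apply: eq_bigr => j _; rewrite /bracket mulrBr.
Qed.

Lemma one_sqr_gt0 (s : R) : 0 < 1 + s ^+ 2.
Proof. by rewrite ltr_pwDl // sqr_ge0. Qed.

Definition weight (lam s : R) := (1 + s ^+ 2) `^ lam.
Definition dweight (lam s : R) := 2 * lam * s * (1 + s ^+ 2) `^ (lam - 1).
Definition ddweight (lam s : R) := 2 * lam * (1 + s ^+ 2) `^ (lam - 1) +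
  4 * lam * (lam - 1) * s ^+ 2 * (1 + s ^+ 2) `^ (lam - 1 - 1).

Lemma smooth_weight lam g : smooth A g -> smooth A (fun q => weight lam (g q)).
Proof.
move=> sg; apply: smooth_powR => [p|]; first exact: one_sqr_gt0.
by apply: smoothD; [exact: smooth_cst|exact: smooth_sqr].
Qed.

Lemma der_one_sqr_powR X g a p : derivation A X -> smooth A g ->
  X (fun q => (1 + g q ^+ 2) `^ a) p = a * (1 + g p ^+ 2) `^ (a - 1) * (2 * g p * X g p).
Proof.
move=> dX sg; have sg2 := smooth_sqr sg; have s1 := @smooth_cst _ _ _ A 1.
rewrite (der_powR dX) //; [|exact: smoothD|by move=> q; exact: one_sqr_gt0].
by rewrite (derD dX) // (der_cst dX) add0r (der_sqr _ dX).
Qed.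

Lemma der_weight X lam g p : derivation A X -> smooth A g ->
  X (fun q => weight lam (g q)) p = dweight lam (g p) * X g p.
Proof. by move=> dX sg; rewrite /weight der_one_sqr_powR // /dweight; ring. Qed.

Lemma der_dweight X lam g p : derivation A X -> smooth A g ->
  X (fun q => dweight lam (g q)) p = ddweight lam (g p) * X g p.
Proof.
move=> dX sg; have s1 := smooth_weight (lam - 1) sg.
have sc := smoothM (@smooth_cst _ _ _ A (2 * lam)) sg.
rewrite /dweight (derM dX) // (derZ _ _ dX) // der_one_sqr_powR // /ddweight; ring.
Qed.

Lemma smooth_dweight lam g : smooth A g -> smooth A (fun q => dweight lam (g q)).
Proof.
move=> sg; apply: smoothM; last exact: (smooth_weight (lam - 1) sg).
by apply: smoothM => //; exact: smooth_cst.
Qed.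

Lemma weight_evolution lam g p : smooth A g ->
  drift_laplacian f (fun q => weight lam (g q)) p =
  dweight lam (g p) * drift_laplacian f g p + ddweight lam (g p) * \sum_(j < d) e j g p ^+ 2.
Proof.
move=> sg; rewrite /drift_laplacian mulrDr -addrA [X in _ = _ + X]addrC addrA; congr (_ + _).
  rewrite /L !mulr_sumr -big_split /=; apply: eq_bigr => j _.
  have sgj := se j sg.
  rewrite (@operator_ext _ _ (e j) _ _ p (fun q => der_weight lam q (de j) sg)).
  rewrite (derM (de j)) //; last exact: smooth_dweight.
  by rewrite (der_dweight _ _ (de j)) //; ring.
rewrite mulrCA; congr (2 * _); rewrite mulr_sumr; apply: eq_bigr => j _.
by rewrite (der_weight _ _ (de j)) // mulrCA.
Qed.

Definition harnack lam delta : M -> R := fun p =>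
  Gamma e f p + \sum_al weight lam (Y e al f p) - delta * v p.

(* The time derivative of [harnack], with [d/dt] commuted past the fields. *)
Definition harnack_dt lam delta : M -> R := fun p =>
  2 * \sum_(j < d) e j f p * e j v p
  + \sum_al dweight lam (Y e al f p) * Y e al v p
  - delta * drift_laplacian f v p.

(** The contribution of [- delta * v] cancels, because [harnack_dt] has [drift_laplacian f v] in the
    place of the time derivative of [v]. The rest is [Gamma_evolution] and the chain rule for the
    weight. *)
Lemma harnack_evolution lam delta p :
  drift_laplacian f (harnack lam delta) p - harnack_dt lam delta p =
  2 * Gamma2 e f p +
  \sum_al (dweight lam (Y e al f p) *
             (L e (Y e al f) p - Y e al (L e f) p
              + 2 * \sum_(j < d) e j f p * bracket (e j) (Y e al) f p)
           + ddweight lam (Y e al f p) * \sum_(j < d) e j (Y e al f) p ^+ 2).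
Proof.
have dY al := derivation_Y al de.
have sY al : smooth A (Y e al f) by exact: der_smooth.
have sS : smooth A (fun p => \sum_al weight lam (Y e al f p)).
  by apply: smooth_sum => al; exact: smooth_weight.
have -> : drift_laplacian f (harnack lam delta) p =
    drift_laplacian f (fun q => (Gamma e f q + \sum_al weight lam (Y e al f q)) + - delta * v q) p.
  by apply: operator_ext => q; rewrite /harnack mulNr.
have sG := smooth_Gamma sf.
rewrite drift_laplacianD; [|exact: smoothD|by apply: smoothM => //; exact: smooth_cst].
rewrite drift_laplacianD // drift_laplacianZ // /harnack_dt mulNr -Gamma_evolution.
rewrite (@drift_laplacian_sum f _ _ (fun al q => weight lam (Y e al f q))); last first.
  by move=> al; exact: smooth_weight.
have E (x y z w k : R) : x + y - k - (z + w - k) = (x - z) + (y - w) by ring.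
rewrite E -sumrB; congr (_ + _); apply: eq_bigr => al _.
by rewrite weight_evolution // -(der_evolution _ (dY al)) mulrBr addrAC.
Qed.

End LogHeat.
End Evolution.

Ltac nonneg := repeat first [assumption | apply: sqr_ge0 | apply: ler0n
  | exact: ler01 | apply: addr_ge0 | apply: mulr_ge0 | by []].

Lemma norm_sum_le_card (R : realType) (I : finType) (F : I -> R) b :
  (forall i, `|F i| <= b) -> `|\sum_i F i| <= #|I|%:R * b.
Proof.
move=> Fb; apply: le_trans (ler_norm_sum _ _ _) _.
by apply: le_trans (ler_sum _ (fun i _ => Fb i)) _; rewrite sumr_const mulr_natl.
Qed.

Lemma norm_mul_le (R : realType) (x y a b : R) : `|x| <= a -> `|y| <= b -> `|x * y| <= a * b.
Proof. by move=> xa yb; rewrite normrM ler_pM. Qed.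

(** * Bounds for commutators and iterated brackets *)

Section BracketBounds.
Context {R : realType} {n d : nat} {M : topologicalType}.
Variables (A : set (chart R n M)) (e : 'I_d -> (M -> R) -> (M -> R)).
Hypothesis de : forall j, derivation A (e j).
Variables (a : idx4 d -> 'I_d -> M -> R) (b : idx4 d -> idx2 d -> M -> R)
  (c : idx4 d -> idx3 d -> M -> R).
Hypotheses (sa : forall q k, smooth A (a q k)) (sb : forall q k, smooth A (b q k))
  (sc : forall q k, smooth A (c q k)).
Hypothesis habc : bracket4_expansion A e a b c.
Variable p : M.
Variable B : R.
Hypotheses (aB : forall q k, `|a q k p| <= B) (bB : forall q k, `|b q k p| <= B)
  (cB : forall q k, `|c q k p| <= B)
  (daB : forall j q k, `|e j (a q k) p| <= B) (dbB : forall j q k, `|e j (b q k) p| <= B)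
  (dcB : forall j q k, `|e j (c q k) p| <= B).
Hypothesis B0 : 0 <= B.
Variable f : M -> R.
Hypothesis sf : smooth A f.
Variables xs ws hs ks : R.
Hypotheses (xs0 : 0 <= xs) (ws0 : 0 <= ws) (hs0 : 0 <= hs) (ks0 : 0 <= ks).
Hypotheses (xb : forall j, `|e j f p| <= xs) (wb : forall al, `|Y e al f p| <= ws)
  (hb : forall i j, `|e i (e j f) p| <= hs) (kb : forall j al, `|e j (Y e al f) p| <= ks).

(** The summand [1] makes the constant at least [1], so that it also covers brackets of length
    three, which are themselves among the [Y_al]. *)
Definition cross_const (d : nat) (B : R) : R :=
  1 + B * (#|'I_d|%:R + #|idx2 d|%:R + #|idx3 d|%:R).

Lemma commutator_L X : derivation A X ->
  L e (X f) p - X (L e f) p = \sum_(j < d)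
    (e j (bracket (e j) X f) p + bracket (e j) X (e j f) p).
Proof.
move=> dX; have sej j g : smooth A g -> smooth A (e j g) by exact: der_smooth.
have sX g : smooth A g -> smooth A (X g) by exact: der_smooth.
rewrite /L (der_sum _ _ dX); last by move=> j; apply: (sej); exact: (sej).
rewrite -sumrB; apply: eq_bigr => j _; rewrite /bracket (derB _ (de j)).
- by rewrite addrA subrK.
- by apply: (sej); exact: sX.
- by apply: (sX); exact: sej.
Qed.

(** This form has [e_j] outermost, at the price of one more bracket. It is used for [e_i] and [Y'],
    where the double bracket has length at most four; for [Y''] it would have length five, and
    [commutator_L] is used instead. *)
Lemma commutator_L2 X : derivation A X ->
  L e (X f) p - X (L e f) p = \sum_(j < d)
    (2 * e j (bracket (e j) X f) p - bracket (e j) (bracket (e j) X) f p).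
Proof.
move=> dX; rewrite commutator_L //; apply: eq_bigr => j _.
set Z := bracket (e j) X.
have -> : bracket (e j) Z f p = e j (Z f) p - Z (e j f) p by [].
ring.
Qed.

(** Both brackets that arise are members of the family [Y], so the bound is free of [B]. This is
    what keeps [diffusion_const] independent of the structure functions. *)
Lemma commutator_e_le i :
  `|L e (e i f) p - e i (L e f) p| <= #|'I_d|%:R * (2 * ks + ws).
Proof.
rewrite commutator_L2 //; apply: norm_sum_le_card => j.
apply: le_trans (ler_normB _ _) _; apply: lerD.
  by rewrite normrM ger0_norm // ler_wpM2l //; exact: (kb j (inl (j, i))).
exact: (wb (inr (j, j, i))).
Qed.

Lemma bracket4_le q : `|bracket4 e q f p| <= cross_const d B * (xs + ws).
Proof.
rewrite habc //.
have h1 : `|\sum_(k < d) a q k p * e k f p| <= #|'I_d|%:R * (B * xs).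
  by apply: norm_sum_le_card => k; exact: norm_mul_le.
have h2 : `|\sum_eta b q eta p * Y' e eta f p| <= #|idx2 d|%:R * (B * ws).
  by apply: norm_sum_le_card => k; apply: norm_mul_le => //; exact: (wb (inl k)).
have h3 : `|\sum_B c q B p * Y'' e B f p| <= #|idx3 d|%:R * (B * ws).
  by apply: norm_sum_le_card => k; apply: norm_mul_le => //; exact: (wb (inr k)).
apply: le_trans (ler_normD _ _) _.
apply: le_trans (lerD (le_trans (ler_normD _ _) (lerD h1 h2)) h3) _.
rewrite /cross_const.
move: (ler0n R #|'I_d|) (ler0n R #|idx2 d|) (ler0n R #|idx3 d|).
move: (#|'I_d|%:R : R) (#|idx2 d|%:R : R) (#|idx3 d|%:R : R) => N1 N2 N3 n1 n2 n3.
rewrite -subr_ge0.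
have -> : (1 + B * (N1 + N2 + N3)) * (xs + ws) -
  (N1 * (B * xs) + N2 * (B * ws) + N3 * (B * ws)) =
  xs + ws + B * N1 * ws + B * N2 * xs + B * N3 * xs by ring.
nonneg.
Qed.

Lemma cross_const_ge1 : 1 <= cross_const d B.
Proof. by rewrite /cross_const lerDl mulr_ge0 // !addr_ge0. Qed.

Lemma cross_le j al : `|bracket (e j) (Y e al) f p| <= cross_const d B * (xs + ws).
Proof.
case: al => [[k l]|[[i k] l]]; last exact: (bracket4_le (j, i, k, l)).
apply: le_trans (wb (inr (j, k, l))) _.
apply: (@le_trans _ _ (xs + ws)); first by rewrite lerDr.
by rewrite ler_peMl ?addr_ge0 // cross_const_ge1.
Qed.

Lemma Ye_le j al : `|Y e al (e j f) p| <= ks + cross_const d B * (xs + ws).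
Proof.
have -> : Y e al (e j f) p = e j (Y e al f) p - bracket (e j) (Y e al) f p.
  by rewrite /bracket opprB addrC subrK.
by apply: le_trans (ler_normB _ _) _; apply: lerD => //; exact: cross_le.
Qed.

(** The square appears because a bracket of length four applied to [e_j f] is expanded once, and the
    resulting [Y_al (e_j f)] are then commuted by [Ye_le], which costs a second factor
    [cross_const]. *)
Definition comm_const (d : nat) (B : R) : R :=
  4 * #|'I_d|%:R * (cross_const d B) ^+ 2.

Lemma bracket4_e_le j q : `|bracket4 e q (e j f) p|
  <= cross_const d B * (hs + (ks + cross_const d B * (xs + ws))).
Proof.
set kk := ks + _.
have kk0 : 0 <= kk.
  exact: (addr_ge0 ks0 (mulr_ge0 (le_trans ler01 cross_const_ge1) (addr_ge0 xs0 ws0))).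
rewrite habc; last exact: der_smooth.
have h1 : `|\sum_(k < d) a q k p * e k (e j f) p| <= #|'I_d|%:R * (B * hs).
  by apply: norm_sum_le_card => k; exact: norm_mul_le.
have h2 : `|\sum_eta b q eta p * Y' e eta (e j f) p| <= #|idx2 d|%:R * (B * kk).
  by apply: norm_sum_le_card => k; apply: norm_mul_le => //; exact: (Ye_le j (inl k)).
have h3 : `|\sum_B c q B p * Y'' e B (e j f) p| <= #|idx3 d|%:R * (B * kk).
  by apply: norm_sum_le_card => k; apply: norm_mul_le => //; exact: (Ye_le j (inr k)).
apply: le_trans (ler_normD _ _) _.
apply: le_trans (lerD (le_trans (ler_normD _ _) (lerD h1 h2)) h3) _.
rewrite /cross_const.
clear h1 h2 h3; move: (ler0n R #|'I_d|) (ler0n R #|idx2 d|) (ler0n R #|idx3 d|) kk kk0.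
move: (#|'I_d|%:R : R) (#|idx2 d|%:R : R) (#|idx3 d|%:R : R) => N1 N2 N3 n1 n2 n3 kk kk0.
rewrite -subr_ge0.
have -> : (1 + B * (N1 + N2 + N3)) * (hs + kk) -
  (N1 * (B * hs) + N2 * (B * kk) + N3 * (B * kk)) =
  hs + kk + B * N1 * kk + B * N2 * hs + B * N3 * hs by ring.
nonneg.
Qed.

(** Differentiating the expansion of the bracket is what brings in the first derivatives of the
    structure functions. *)
Lemma e_bracket4_le j q : `|e j (bracket4 e q f) p|
  <= cross_const d B * (xs + ws + hs + ks).
Proof.
have sY' eta : smooth A (Y' e eta f) by apply: der_smooth => //; exact: derivation_Y'.
have sY'' al : smooth A (Y'' e al f) by apply: der_smooth => //; exact: derivation_Y''.
have se k : smooth A (e k f) by exact: der_smooth.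
rewrite (@operator_ext _ _ (e j) _ _ p (fun r => habc q sf r)).
have sA : smooth A (fun r => \sum_(k < d) a q k r * e k f r).
  by apply: smooth_sum => k; exact: smoothM.
have sB : smooth A (fun r => \sum_eta b q eta r * Y' e eta f r).
  by apply: smooth_sum => k; exact: smoothM.
have sC : smooth A (fun r => \sum_al c q al r * Y'' e al f r).
  by apply: smooth_sum => k; exact: smoothM.
rewrite (derD (de j)) //; last exact: smoothD.
rewrite (derD (de j)) //.
have h1 : `|e j (fun r => \sum_(k < d) a q k r * e k f r) p| <= #|'I_d|%:R * (B * xs + B * hs).
  rewrite (der_sum _ _ (de j)); last by move=> k; exact: smoothM.
  apply: norm_sum_le_card => k; rewrite (derM (de j)) //.
  by apply: le_trans (ler_normD _ _) _; apply: lerD; exact: norm_mul_le.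
have h2 : `|e j (fun r => \sum_eta b q eta r * Y' e eta f r) p| <= #|idx2 d|%:R * (B * ws + B * ks).
  rewrite (der_sum _ _ (de j)); last by move=> k; exact: smoothM.
  apply: norm_sum_le_card => k; rewrite (derM (de j)) //.
  apply: le_trans (ler_normD _ _) _; apply: lerD; apply: norm_mul_le => //.
    exact: (wb (inl k)).
  exact: (kb j (inl k)).
have h3 : `|e j (fun r => \sum_al c q al r * Y'' e al f r) p| <= #|idx3 d|%:R * (B * ws + B * ks).
  rewrite (der_sum _ _ (de j)); last by move=> k; exact: smoothM.
  apply: norm_sum_le_card => k; rewrite (derM (de j)) //.
  apply: le_trans (ler_normD _ _) _; apply: lerD; apply: norm_mul_le => //.
    exact: (wb (inr k)).
  exact: (kb j (inr k)).
apply: le_trans (ler_normD _ _) _.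
apply: le_trans (lerD (le_trans (ler_normD _ _) (lerD h1 h2)) h3) _.
rewrite /cross_const.
move: (ler0n R #|'I_d|) (ler0n R #|idx2 d|) (ler0n R #|idx3 d|).
move: (#|'I_d|%:R : R) (#|idx2 d|%:R : R) (#|idx3 d|%:R : R) => N1 N2 N3 n1 n2 n3.
rewrite -subr_ge0.
have -> : (1 + B * (N1 + N2 + N3)) * (xs + ws + hs + ks) -
  (N1 * (B * xs + B * hs) + N2 * (B * ws + B * ks) + N3 * (B * ws + B * ks)) =
  xs + ws + hs + ks + B * N1 * (ws + ks) + B * N2 * (xs + hs) + B * N3 * (xs + hs) by ring.
by rewrite !addr_ge0 // ?mulr_ge0 // ?addr_ge0 // ?mulr_ge0.
Qed.

Lemma commutator_Y_le al :
  `|L e (Y e al f) p - Y e al (L e f) p| <= comm_const d B * (xs + ws + hs + ks).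
Proof.
have C1 := cross_const_ge1; have d0 := ler0n R #|'I_d|.
have s0 : 0 <= xs + ws by exact: addr_ge0.
case: al => [[k l]|[[i k] l]].
  rewrite commutator_L2; last exact: (derivation_Y (inl (k, l)) de).
  rewrite /comm_const [4 * _]mulrC -!mulrA; apply: norm_sum_le_card => j.
  apply: le_trans (ler_normB _ _) _.
  have h1 : `|2 * e j (bracket (e j) (Y e (inl (k, l))) f) p| <= 2 * ks.
    by rewrite normrM ger0_norm // ler_wpM2l //; exact: (kb j (inr (j, k, l))).
  apply: le_trans (lerD h1 (bracket4_le (j, j, k, l))) _.
  move: C1 s0; move: (cross_const d B) => C C1 s0.
  have C0 : 0 <= C - 1 by rewrite subr_ge0.
  rewrite -subr_ge0.
  (* Expanded in powers of [C - 1 >= 0], the difference has only nonnegative coefficients. *)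
  have -> : 4 * (C * (C * (xs + ws + hs + ks))) - (2 * ks + C * (xs + ws))
    = (4 * (C - 1) ^+ 2 + 7 * (C - 1) + 3) * (xs + ws)
      + (4 * (C - 1) ^+ 2 + 8 * (C - 1) + 2) * ks
      + 4 * C ^+ 2 * hs by ring.
  nonneg.
rewrite commutator_L; last exact: (derivation_Y (inr (i, k, l)) de).
rewrite /comm_const [4 * _]mulrC -!mulrA; apply: norm_sum_le_card => j.
apply: le_trans (ler_normD _ _) _.
apply: le_trans (lerD (e_bracket4_le j (j, i, k, l)) (bracket4_e_le j (j, i, k, l))) _.
move: C1 s0; move: (cross_const d B) => C C1 s0.
have C0 : 0 <= C - 1 by rewrite subr_ge0.
rewrite -subr_ge0.
have -> : 4 * (C * (C * (xs + ws + hs + ks))) -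
    (C * (xs + ws + hs + ks) + C * (hs + (ks + C * (xs + ws))))
  = (3 * (C - 1) ^+ 2 + 5 * (C - 1) + 2) * (xs + ws)
    + (4 * (C - 1) ^+ 2 + 6 * (C - 1) + 2) * (hs + ks) by ring.
nonneg.
Qed.

End BracketBounds.

(** * Absorption of error terms by completing squares *)

Section RealInequalities.
Context {R : realType}.
Implicit Types (x r h k P T eps C D u : R).

Lemma complete_square h C P : - (C * P) ^+ 2 <= h ^+ 2 - C * P * h.
Proof.
rewrite -subr_ge0.
have -> : h ^+ 2 - C * P * h - - (C * P) ^+ 2
  = (h - C * P / 2) ^+ 2 + 3 / 4 * (C * P) ^+ 2 by field.
by rewrite addr_ge0 ?sqr_ge0 // mulr_ge0 ?sqr_ge0 // divr_ge0.
Qed.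

(** Completing the square costs [(2 b + c)^2 / (4 eps u)], which [(2 b - c)^2 >= 0] splits into a
    part in [b] and a part in [c]. The split is essential: [b] feeds the critical term and must not
    be mixed with [c], which carries the structure functions. *)
Lemma weighted_square eps u k b c : 0 < eps -> 0 < u ->
  - ((2 * b ^+ 2) / eps / u + c ^+ 2 / (2 * eps) / u) <= eps * u * k ^+ 2 - (2 * b + c) * k.
Proof.
move=> e0 u0; rewrite -subr_ge0.
have e1 : eps != 0 by rewrite gt_eqF.
have u1 : u != 0 by rewrite gt_eqF.
have -> : eps * u * k ^+ 2 - (2 * b + c) * k - - ((2 * b ^+ 2) / eps / u + c ^+ 2 / (2 * eps) / u)
  = (eps * u * k - (2 * b + c) / 2) ^+ 2 / (eps * u) + (2 * b - c) ^+ 2 / (4 * eps * u).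
  by field; rewrite e1 u1.
by rewrite addr_ge0 // divr_ge0 ?sqr_ge0 // ?mulr_ge0 // ltW // mulr_gt0 // mulr_gt0.
Qed.

(** Here [x^2 = X], [r^2 = W], [h^2] and [k^2] are the sums of the [(e_j e_i f)^2] and of the
    [(e_j Y_al f)^2], [P = W^(lam-1/2)], [T = W^(lam/2)], so [P / r = W^(lam-1)]. After [h] and [k]
    are removed by completing squares, every remaining monomial except the critical [x^2 * (r / P)]
    is at most [Z = x^2 T + T^3]. *)
Lemma evolution_algebra x r h k P T eps C3 C4 D2 kappa rho1 rho2 :
  0 <= x -> 1 <= r -> 1 <= P -> P <= T -> T ^+ 2 = P * r -> 0 < eps ->
  0 <= C3 -> 0 <= C4 -> 0 <= D2 -> 0 <= rho2 ->
  rho2 * r ^+ 2 - (kappa / eps + 2 * D2 ^+ 2 / eps) * (x ^+ 2 * (r / P))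
   - (`|rho1| + rho2 + D2 + C3 ^+ 2 + C3 ^+ 2 / (2 * eps) + 2 * C3 + 2 * C4)
     * (x ^+ 2 * T + T ^+ 3)
  <= h ^+ 2 - D2 * x * (2 * k + r) + (rho1 - kappa / (eps * (P / r))) * x ^+ 2
     + rho2 * (r ^+ 2 - 1) + eps * (P / r) * k ^+ 2
     - C3 * P * (x + r + h + k) - C4 * P * x * (x + r).
Proof.
move=> x0 r1 P1 PT TT e0 C30 C40 D20 rho20.
have r0 : 0 < r := lt_le_trans ltr01 r1.
have P0 : 0 < P := lt_le_trans ltr01 P1.
have T1 : 1 <= T := le_trans P1 PT.
have T0 : 0 < T := lt_le_trans ltr01 T1.
have x20 : 0 <= x ^+ 2 := sqr_ge0 x.
have TT3 : T ^+ 2 <= T ^+ 3 by rewrite exprS ler_peMl ?sqr_ge0.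
have T1T : T <= T ^+ 2 by rewrite expr2 ler_peMl // ltW.
have rT2 : r <= T ^+ 2 by rewrite TT ler_peMl // ltW.
have PP : P ^+ 2 <= T ^+ 3.
  apply: le_trans TT3; rewrite ler_pXn2r // ?nnegrE ltW //.
set Z := x ^+ 2 * T + T ^+ 3.
have x2T : 0 <= x ^+ 2 * T by rewrite mulr_ge0 // ltW.
have Z3 : T ^+ 3 <= Z by rewrite lerDr.
have ZZ : T ^+ 2 * x <= Z.
  rewrite -subr_ge0 /Z.
  have -> : x ^+ 2 * T + T ^+ 3 - T ^+ 2 * x = T * ((x - T / 2) ^+ 2 + 3 / 4 * T ^+ 2) by field.
  by rewrite mulr_ge0 // ?ltW // ltr_wpDl ?sqr_ge0 // mulr_gt0 ?exprn_gt0 // divr_gt0.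
have b3 : x * r <= Z.
  by apply: le_trans ZZ; rewrite mulrC ler_wpM2r.
have b4 : P * x <= Z.
  by apply: le_trans ZZ; rewrite ler_wpM2r // (le_trans PT).
have b5 : P * r <= Z by rewrite -TT (le_trans TT3).
have b6 : P * x ^+ 2 <= Z.
  apply: (@le_trans _ _ (x ^+ 2 * T)); first by rewrite mulrC ler_wpM2l.
  by rewrite lerDl exprn_ge0 // ltW.
have b6' : P * x * r <= Z by rewrite mulrAC -TT.
have b7 : `|rho1| * x ^+ 2 <= `|rho1| * Z.
  apply: ler_wpM2l => //; apply: (@le_trans _ _ (x ^+ 2 * T)).
    by rewrite ler_peMr.
  by rewrite lerDl exprn_ge0 // ltW.
have b8 : 1 <= Z by rewrite (le_trans _ Z3) // (le_trans T1) // (le_trans T1T).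
have nz : (P != 0) && (r != 0) by rewrite !gt_eqF.
have /andP[nP nr] := nz.
have ne : eps != 0 by rewrite gt_eqF.
have u0 : 0 < P / r by rewrite divr_gt0.
have t2 := weighted_square k (D2 * x) (C3 * P) e0 u0.
have t1 := complete_square h C3 P.
have Pu : P ^+ 2 / (P / r) = T ^+ 2 by rewrite TT; field; rewrite nP nr.
have e1 : C3 ^+ 2 / (2 * eps) * T ^+ 2 <= C3 ^+ 2 / (2 * eps) * Z.
  apply: ler_wpM2l; last exact: le_trans Z3.
  by rewrite divr_ge0 ?sqr_ge0 // mulr_ge0 // ltW.
have t2' : - (2 * D2 ^+ 2 / eps * (x ^+ 2 * (r / P)) + C3 ^+ 2 / (2 * eps) * Z)
   <= eps * (P / r) * k ^+ 2 - (2 * (D2 * x) + C3 * P) * k.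
  apply: le_trans t2; rewrite lerN2; apply: lerD.
    have -> // : 2 * (D2 * x) ^+ 2 / eps / (P / r) = 2 * D2 ^+ 2 / eps * (x ^+ 2 * (r / P)).
    by field; rewrite nP nr ne.
  apply: le_trans e1; rewrite -Pu.
  have -> // : (C3 * P) ^+ 2 / (2 * eps) / (P / r) = C3 ^+ 2 / (2 * eps) * (P ^+ 2 / (P / r)).
  by field; rewrite nP nr ne.
have t1' : - (C3 ^+ 2 * Z) <= h ^+ 2 - C3 * P * h.
  apply: le_trans t1; rewrite lerN2 exprMn; apply: ler_wpM2l; first exact: sqr_ge0.
  exact: le_trans PP Z3.
have b7' : - (`|rho1| * x ^+ 2) <= rho1 * x ^+ 2.
  by rewrite -mulNr ler_wpM2r // lerNl -normrN ler_norm.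
have c3 := ler_wpM2l D20 b3; have c4 := ler_wpM2l C30 b4; have c5 := ler_wpM2l C30 b5.
have c6 := ler_wpM2l C40 b6; have c6' := ler_wpM2l C40 b6'; have c8 := ler_wpM2l rho20 b8.
have k1 : kappa / (eps * (P / r)) * x ^+ 2 = kappa / eps * (x ^+ 2 * (r / P)).
  by field; rewrite nP nr ne.
rewrite -subr_ge0.
have -> : h ^+ 2 - D2 * x * (2 * k + r) + (rho1 - kappa / (eps * (P / r))) * x ^+ 2
     + rho2 * (r ^+ 2 - 1) + eps * (P / r) * k ^+ 2
     - C3 * P * (x + r + h + k) - C4 * P * x * (x + r) -
   (rho2 * r ^+ 2 - (kappa / eps + 2 * D2 ^+ 2 / eps) * (x ^+ 2 * (r / P))
   - (`|rho1| + rho2 + D2 + C3 ^+ 2 + C3 ^+ 2 / (2 * eps) + 2 * C3 + 2 * C4) * Z) =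
   (h ^+ 2 - C3 * P * h + C3 ^+ 2 * Z)
   + (eps * (P / r) * k ^+ 2 - (2 * (D2 * x) + C3 * P) * k
       + (2 * D2 ^+ 2 / eps * (x ^+ 2 * (r / P)) + C3 ^+ 2 / (2 * eps) * Z))
   + (D2 * Z - D2 * (x * r)) + (C3 * Z - C3 * (P * x)) + (C3 * Z - C3 * (P * r))
   + (C4 * Z - C4 * (P * x ^+ 2)) + (C4 * Z - C4 * (P * x * r)) + (rho2 * Z - rho2 * 1)
   + (rho1 * x ^+ 2 + `|rho1| * x ^+ 2) + (`|rho1| * Z - `|rho1| * x ^+ 2).
  rewrite [(rho1 - _) * _]mulrBl k1.
  move: (eps * (P / r) * k ^+ 2) (x ^+ 2 * (r / P)) (kappa / eps) (2 * D2 ^+ 2 / eps)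
    (C3 ^+ 2 / (2 * eps)) `|rho1| => *; ring.
have N (y z : R) : - z <= y -> 0 <= y + z by rewrite -lerBlDr sub0r.
have S (y z : R) : y <= z -> 0 <= z - y by rewrite subr_ge0.
apply: (addr_ge0 _ (S _ _ b7)); apply: (addr_ge0 _ (N _ _ b7')).
apply: (addr_ge0 _ (S _ _ c8)); apply: (addr_ge0 _ (S _ _ c6')).
apply: (addr_ge0 _ (S _ _ c6)); apply: (addr_ge0 _ (S _ _ c5)).
apply: (addr_ge0 _ (S _ _ c4)); apply: (addr_ge0 _ (S _ _ c3)).
exact: (addr_ge0 (N _ _ t1') (N _ _ t2')).
Qed.

End RealInequalities.

(** * From the evolution inequality to a bound at a maximum point *)

Section PointwiseBound.
Context {R : realType}.

Lemma powR_gt0D (W r s : R) : 0 < W -> W `^ (r + s) = W `^ r * W `^ s.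
Proof. by move=> W0; rewrite powRD //; apply/implyP => _; rewrite gt_eqF. Qed.

Lemma powR_young (s c eta : R) : 0 < eta -> 0 <= c -> s < 1 ->
  exists2 K, 0 <= K & forall W, 1 <= W -> c * W `^ s <= eta * W + K.
Proof.
move=> eta0 c0 s1; have s10 : 0 < 1 - s by rewrite subr_gt0.
(* The threshold where [c W^s = eta W]: above it the linear term wins, below it [W^s <= W <= K]. *)
pose K := (c / eta) `^ (1 - s)^-1.
have K0 : 0 <= K by exact: powR_ge0.
exists (c * K) => [|W W1]; first exact: mulr_ge0.
have W0 : 0 < W := lt_le_trans ltr01 W1.
have ce0 : 0 <= c / eta by rewrite divr_ge0 // ltW.
case: (lerP W K) => WK.
  apply: (@le_trans _ _ (c * K)); last by rewrite lerDr mulr_ge0 // ltW.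
  rewrite ler_wpM2l //; apply: le_trans WK; exact: ler1_powR W1 (ltW s1).
have : c / eta <= W `^ (1 - s).
  have -> : c / eta = K `^ (1 - s).
    by rewrite -powRrM mulVf ?powRr1 // gt_eqF.
  by apply: ge0_ler_powR; rewrite ?nnegrE //; exact: ltW.
rewrite ler_pdivrMr // => cW.
rewrite -[leLHS]addr0; apply: lerD; last exact: mulr_ge0.
apply: le_trans (ler_wpM2r (powR_ge0 _ _) cW) _.
by rewrite mulrAC -powR_gt0D // subrK (powRr1 (ltW W0)) mulrC.
Qed.

(** With [y], [z], [t], [T3] the powers of [W] of exponents [lam], [1 - lam], [lam/2], [3 lam/2],
    half of [rho2 W] absorbs the critical term; this is the origin of [4 N Cs / rho2 <= delta - 1].
    A quarter absorbs the lower-order terms and a quarter remains. *)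
Lemma small_diffusion_alg (X W S g HG y z t T3 rho2 N Cs C delta m LL tau K : R) :
  0 < rho2 -> 0 < N -> 0 <= Cs -> 0 <= C -> 0 < m -> 1 < delta ->
  4 * N * Cs / rho2 <= delta - 1 -> 0 <= y -> 0 <= z -> 0 <= t -> y * z = W -> y * t = T3 ->
  0 <= X -> S <= N * y -> g + (delta - 1) * X <= 2 * S -> 0 < g -> 0 < tau ->
  C * (2 * N / (delta - 1) + 1) * T3 <= rho2 / 4 * W + K ->
  m^-1 * LL ^+ 2 + rho2 * W - Cs * (X * z) - C * (X * t + T3) <= HG ->
  HG <= 2 * g / tau ->
  g <= 2 * N * y /\ rho2 / 4 * W <= K + 4 * N * y / tau.
Proof.
move=> r0 N0 Cs0 C0 m0 d1 dl y0 z0 t0 yz yt X0 SN AA g0 tau0 young low up.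
have d10 : 0 < delta - 1 by rewrite subr_gt0.
have dX0 : 0 <= (delta - 1) * X by rewrite mulr_ge0 // ltW.
have S2 : 2 * S <= 2 * N * y by rewrite -mulrA ler_wpM2l.
have gy : g <= 2 * N * y.
  by apply: le_trans S2; apply: le_trans AA; rewrite lerDl.
split=> //.
have Xy : X <= 2 * N / (delta - 1) * y.
  rewrite mulrAC ler_pdivlMr // mulrC; apply: le_trans S2; apply: le_trans AA.
  by rewrite lerDr ltW.
have Nd : 2 * N / (delta - 1) * Cs <= rho2 / 2.
  rewrite mulrAC ler_pdivrMr //.
  have := dl; rewrite ler_pdivrMr // => dl'.
  move: dl'; rewrite -subr_ge0 => dl'; rewrite -subr_ge0.
  have -> : rho2 / 2 * (delta - 1) - 2 * N * Cs =
      ((delta - 1) * rho2 - 4 * N * Cs) / 2 by field.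
  by rewrite divr_ge0.
have W0 : 0 <= W by rewrite -yz mulr_ge0.
have h1 : Cs * (X * z) <= rho2 / 2 * W.
  apply: le_trans (ler_wpM2r W0 Nd); rewrite -yz.
  have -> : 2 * N / (delta - 1) * Cs * (y * z) = Cs * (2 * N / (delta - 1) * y * z) by ring.
  by rewrite ler_wpM2l // ler_wpM2r.
have h2 : C * (X * t + T3) <= C * (2 * N / (delta - 1) + 1) * T3.
  rewrite -mulrA ler_wpM2l // mulrDl mul1r lerD2r -yt mulrA.
  by rewrite ler_wpM2r.
have h3 : 0 <= m^-1 * LL ^+ 2 by rewrite mulr_ge0 ?sqr_ge0 // invr_ge0 ltW.
have h4 : 2 * g / tau <= 4 * N * y / tau.
  rewrite ler_pM2r ?invr_gt0 //.
  have -> : 4 * N * y = 2 * (2 * N * y) by ring.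
  by rewrite ler_wpM2l.
move: low up young h1 h2 h3 h4.
move: (m^-1 * _) (Cs * _) (C * (X * t + T3)) (C * _ * T3) (2 * g / tau) (4 * N * y / tau) => *; lra.
Qed.

(** Since [S] is at most half of [g + (delta - 1) X], [- delta LL] is at least the other half, which
    gives the squares of [g] and [X]. The term [c1 X^2] is halved to absorb [Cs X z] and [C X t];
    this leaves [z^2] and [t^2], of exponents [2 - 2 lam] and [lam], both below [1], and three
    quarters of [rho2 W] cover these and [T3]. *)
Lemma large_diffusion_alg (X W S g HG z t T3 rho2 Cs C delta m LL tau K1 K2 K3 : R) :
  let c1 := (delta - 1) ^+ 2 / (4 * delta ^+ 2 * m) in
  0 < rho2 -> 0 <= Cs -> 0 <= C -> 0 < m -> 1 < delta -> 1 <= W ->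
  0 <= X -> 2 * S <= g + (delta - 1) * X -> 0 < g -> 0 < tau ->
  g = X + S - delta * (LL + X) ->
  Cs ^+ 2 / (2 * c1) * z ^+ 2 <= rho2 / 4 * W + K1 ->
  C ^+ 2 / (2 * c1) * t ^+ 2 <= rho2 / 4 * W + K2 ->
  C * T3 <= rho2 / 4 * W + K3 ->
  m^-1 * LL ^+ 2 + rho2 * W - Cs * (X * z) - C * (X * t + T3) <= HG ->
  HG <= 2 * g / tau ->
  g ^+ 2 / (4 * delta ^+ 2 * m) <= K1 + K2 + K3 + 2 * g / tau.
Proof.
move=> c1 r0 Cs0 C0 m0 d1 W1 X0 SE g0 tau0 gE y1 y2 y3 low up.
have d0 : 0 < delta := lt_trans ltr01 d1.
have d10 : 0 < delta - 1 by rewrite subr_gt0.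
have nd : delta != 0 by rewrite gt_eqF.
have nm : m != 0 by rewrite gt_eqF.
have nd1 : delta - 1 != 0 by rewrite gt_eqF.
have D0 : 0 < 4 * delta ^+ 2 * m by rewrite !mulr_gt0 // exprn_gt0.
have c10 : 0 < c1 by rewrite divr_gt0 // exprn_gt0.
have E0 : 0 <= g + (delta - 1) * X by rewrite addr_ge0 ?mulr_ge0 // ltW.
have LLE : delta * LL = - (g + (delta - 1) * X - S) by rewrite gE; ring.
have L1 : g ^+ 2 / (4 * delta ^+ 2 * m) + c1 * X ^+ 2 <= m^-1 * LL ^+ 2.
  have -> : m^-1 * LL ^+ 2 = (2 * (g + (delta - 1) * X - S)) ^+ 2 / (4 * delta ^+ 2 * m).
    have -> : g + (delta - 1) * X - S = - (delta * LL) by rewrite LLE opprK.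
    by field; rewrite nd nm.
  rewrite /c1 [_ / _ * X ^+ 2]mulrAC -mulrDl ler_pM2r ?invr_gt0 //.
  apply: (@le_trans _ _ ((g + (delta - 1) * X) ^+ 2)).
    rewrite -subr_ge0.
    have -> : (g + (delta - 1) * X) ^+ 2 - (g ^+ 2 + (delta - 1) ^+ 2 * X ^+ 2)
      = 2 * (g * ((delta - 1) * X)) by ring.
    by rewrite !mulr_ge0 // ltW.
  rewrite ler_pXn2r ?nnegrE //.
    by move: E0 SE; move: (g + _) => u *; lra.
  by move: E0 SE; move: (g + _) => u *; lra.
have nc : c1 != 0 by rewrite gt_eqF.
have young (a b : R) : a * (X * b) <= c1 / 2 * X ^+ 2 + a ^+ 2 / (2 * c1) * b ^+ 2.
  rewrite -subr_ge0.
  have -> : c1 / 2 * X ^+ 2 + a ^+ 2 / (2 * c1) * b ^+ 2 - a * (X * b)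
     = (c1 * X - a * b) ^+ 2 / (2 * c1) by field.
  by rewrite divr_ge0 ?sqr_ge0 // mulr_ge0 // ltW.
have z1 := young Cs z; have z2 := young C t.
have W0 : 0 <= rho2 * W by rewrite mulr_ge0 // ltW // (lt_le_trans ltr01).
have cc : c1 * X ^+ 2 = c1 / 2 * X ^+ 2 + c1 / 2 * X ^+ 2 by field.
rewrite cc in L1.
have Ct : C * (X * t + T3) = C * (X * t) + C * T3 by rewrite mulrDr.
rewrite Ct in low.
move: low up L1 z1 z2 y1 y2 y3 W0.
move: (c1 / 2 * X ^+ 2) (m^-1 * _) (Cs * _) (C * (X * t)) (C * T3) (2 * g / tau) (Cs ^+ 2 / _ * _)
  (C ^+ 2 / _ * _) (g ^+ 2 / _) => *; lra.
Qed.

(** If the bound failed, the summand [1] would force [g > 1], hence [c K <= c K g], and [g^2] would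
    exceed [c K + c k g]. *)
Lemma quadratic_bound (g c K k : R) : 0 < c -> 0 <= K -> 0 <= k -> 0 < g ->
  g ^+ 2 / c <= K + k * g -> g <= c * K + 1 + c * k.
Proof.
move=> c0 K0 k0 g0 h; rewrite leNgt; apply/negP => lt.
have cK : 0 <= c * K by rewrite mulr_ge0 // ltW.
have ck : 0 <= c * k by rewrite mulr_ge0 // ltW.
have h' : g ^+ 2 <= c * K + c * k * g.
  by move: h; rewrite ler_pdivrMr // mulrC mulrDr mulrA.
have g1 : 1 < g by apply: le_lt_trans lt; rewrite -addrA addrCA lerDl addr_ge0.
have : (c * K + 1 + c * k) * g < g ^+ 2 by rewrite expr2 ltr_pM2r.
have : c * K <= c * K * g by rewrite ler_peMr // ltW.
rewrite !mulrDl mul1r; move: h' g0; move: (g ^+ 2) (c * K) (c * k * g) (c * K * g) => *; lra.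
Qed.

(** Either [K] dominates and [W <= 8 K / rho2], or [W^(1-lam) <= 32 N / (rho2 tau)]. Raising the
    latter to the power [lam / (1 - lam)] is the origin of the exponent [lam / (lam - 1)] of
    time. *)
Lemma dominated_power (lam N rho2 K W tau g : R) : 1 / 2 < lam -> lam < 2 / 3 ->
  0 < N -> 0 < rho2 -> 0 <= K -> 1 <= W -> 0 < tau ->
  g <= 2 * N * W `^ lam -> rho2 / 4 * W <= K + 4 * N * W `^ lam / tau ->
  g <= 2 * N * (8 * K / rho2)
       + 2 * N * (32 * N / rho2) `^ (lam / (1 - lam)) * tau `^ (lam / (lam - 1)).
Proof.
move=> l1 l2 N0 r0 K0 W1 tau0 gW WW.
have W0 : 0 < W := lt_le_trans ltr01 W1.
have lam1 : 0 < 1 - lam by clear -l2; lra.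
have lam0 : 0 < lam by clear -l1; lra.
have N20 : 0 <= 2 * N by rewrite mulr_ge0 // ltW.
have p1 : 0 <= 2 * N * (8 * K / rho2).
  by rewrite mulr_ge0 // divr_ge0 ?mulr_ge0 // ltW.
have p2 : 0 <= 2 * N * (32 * N / rho2) `^ (lam / (1 - lam)) * tau `^ (lam / (lam - 1)).
  exact: (mulr_ge0 (mulr_ge0 N20 (powR_ge0 _ _)) (powR_ge0 _ _)).
apply: le_trans gW _.
case: (lerP (4 * N * W `^ lam / tau) K) => h.
  apply: (@le_trans _ _ (2 * N * (8 * K / rho2))); last by rewrite lerDl.
  rewrite ler_wpM2l //; apply: le_trans (ler1_powR W1 _) _.
    by rewrite -subr_ge0; exact: ltW lam1.
  rewrite ler_pdivlMr // [W * _]mulrC; move: WW h; move: (4 * N * _ / _) => q.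
  have -> : rho2 / 4 * W = rho2 * W / 4 by field.
  by move: (rho2 * W) => w ? ?; lra.
apply: (@le_trans _ _ (2 * N * (32 * N / rho2) `^ (lam / (1 - lam)) * tau `^ (lam / (lam - 1)))); last by rewrite lerDr.
rewrite -[leRHS]mulrA ler_wpM2l //.
have k0 : 0 <= 32 * N / rho2 by rewrite divr_ge0 ?mulr_ge0 // ltW.
have zle : W `^ (1 - lam) <= 32 * N / rho2 / tau.
  have : rho2 / 4 * W <= 2 * (4 * N * W `^ lam / tau).
    by apply: le_trans WW _; move: h; move: (4 * N * _ / _) => q ?; lra.
  have {1}-> : W = W `^ lam * W `^ (1 - lam).
    by rewrite -powR_gt0D // addrC subrK powRr1 // ltW.
  have Wl := powR_gt0 lam W0.
  move: (W `^ (1 - lam)) (W `^ lam) Wl => z y y0 hh.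
  rewrite -(ler_pM2l (mulr_gt0 (divr_gt0 r0 (ltr0n R 4)) y0)).
  have -> : rho2 / 4 * y * z = rho2 / 4 * (y * z) by ring.
  apply: le_trans hh _.
  have -> // : 2 * (4 * N * y / tau) = rho2 / 4 * y * (32 * N / rho2 / tau).
  by field; rewrite !gt_eqF.
have q0 : 0 <= lam / (1 - lam) by rewrite divr_ge0 // ltW.
have -> : W `^ lam = (W `^ (1 - lam)) `^ (lam / (1 - lam)).
  by rewrite -powRrM mulrC divfK // gt_eqF.
apply: le_trans (ge0_ler_powR q0 _ _ zle) _; rewrite ?nnegrE ?powR_ge0 //.
  by rewrite divr_ge0 // ltW.
rewrite powRM // ?invr_ge0 ?(ltW tau0) // -(powR_inv1 (ltW tau0)) -powRrM.
have -> // : -1 * (lam / (1 - lam)) = lam / (lam - 1).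
have n1 : 1 - lam != 0 by rewrite gt_eqF.
have n2 : lam - 1 != 0 by rewrite -opprB oppr_eq0.
by field; rewrite n1 n2.
Qed.

(** As [lam > 1/2], the exponent [lam / (1 - lam)] exceeds [1], so for small [tau] the power
    dominates [1 / tau]. Both cases of the argument thus yield a bound of the same shape. *)
Lemma inv_le_powR (lam tau : R) : 1 / 2 < lam -> lam < 2 / 3 -> 0 < tau ->
  tau^-1 <= 1 + tau `^ (lam / (lam - 1)).
Proof.
move=> l1 l2 t0.
have lam1 : 0 < 1 - lam by clear -l2; lra.
have n1 : 1 - lam != 0 by rewrite gt_eqF.
have n2 : lam - 1 != 0 by rewrite -opprB oppr_eq0.
have -> : lam / (lam - 1) = -1 * (lam / (1 - lam)) by field; rewrite n1 n2.
rewrite powRrM powR_inv1 ?(ltW t0) //.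
case: (lerP tau^-1 1) => h; first by rewrite (le_trans h) // lerDl powR_ge0.
apply: (@le_trans _ _ (tau^-1 `^ (lam / (1 - lam)))); last by rewrite lerDr.
apply: le1r_powR; first exact: ltW.
by rewrite ler_pdivlMr // mul1r; clear -l1; lra.
Qed.

Lemma sum_le_split (a b c d f x : R) : a <= b + d -> 0 <= c -> 0 <= f ->
  x + 1 + a <= f + (x + 1 + b) + (c + d).
Proof. lra. Qed.

Lemma evolution_bound (lam rho2 m delta Cs C N : R) : 1 / 2 < lam -> lam < 2 / 3 ->
  0 < rho2 -> 0 < m -> 0 <= Cs -> 0 <= C -> 0 < N -> 1 < delta ->
  4 * N * Cs / rho2 <= delta - 1 ->
  exists A B, [/\ 0 <= A, 0 <= B & forall X W S LL g HG tau : R,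
    0 <= X -> 1 <= W -> S <= N * W `^ lam -> g = X + S - delta * (LL + X) ->
    0 < g -> 0 < tau ->
    m^-1 * LL ^+ 2 + rho2 * W - Cs * (X * W `^ (1 - lam))
      - C * (X * W `^ (lam / 2) + W `^ (3 * lam / 2)) <= HG ->
    HG <= 2 * g / tau -> g <= A + B * tau `^ (lam / (lam - 1))].
Proof.
move=> l1 l2 r0 m0 Cs0 C0 N0 d1 dl.
have d0 : 0 < delta := lt_trans ltr01 d1.
have d10 : 0 < delta - 1 by rewrite subr_gt0.
have D0 : 0 < 4 * delta ^+ 2 * m by rewrite !mulr_gt0 // exprn_gt0.
have r40 : 0 < rho2 / 4 by rewrite divr_gt0.
pose c1 := (delta - 1) ^+ 2 / (4 * delta ^+ 2 * m).
have c10 : 0 < c1 by rewrite divr_gt0 // exprn_gt0.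
have s1 : 3 * lam / 2 < 1 by clear -l2; lra.
have s2 : 2 * (1 - lam) < 1 by clear -l1; lra.
have s3 : lam < 1 by clear -l2; lra.
have k1 : 0 <= C * (2 * N / (delta - 1) + 1).
  by rewrite mulr_ge0 // addr_ge0 // divr_ge0 ?mulr_ge0 // ltW.
have k2 : 0 <= Cs ^+ 2 / (2 * c1) by rewrite divr_ge0 ?sqr_ge0 // mulr_ge0 // ltW.
have k3 : 0 <= C ^+ 2 / (2 * c1) by rewrite divr_ge0 ?sqr_ge0 // mulr_ge0 // ltW.
have [K K0 yK] := powR_young r40 k1 s1.
have [K1 K10 yK1] := powR_young r40 k2 s2.
have [K2 K20 yK2] := powR_young r40 k3 s3.
have [K3 K30 yK3] := powR_young r40 C0 s1.
pose A1 := 2 * N * (8 * K / rho2).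
pose B1 := 2 * N * (32 * N / rho2) `^ (lam / (1 - lam)).
pose D := 4 * delta ^+ 2 * m.
have A10 : 0 <= A1 by rewrite /A1 !mulr_ge0 ?invr_ge0 // ltW.
have B10 : 0 <= B1 by rewrite /B1 !mulr_ge0 ?powR_ge0 // ltW.
have A20 : 0 <= D * (K1 + K2 + K3) + 1.
  by rewrite addr_ge0 // mulr_ge0 ?addr_ge0 // ltW.
have B20 : 0 <= D * 2 by rewrite mulr_ge0 // ltW.
(* The constants of the two cases are added, which avoids a maximum. *)
exists (A1 + (D * (K1 + K2 + K3) + 1 + D * 2)), (B1 + D * 2).
split; [exact: (addr_ge0 A10 (addr_ge0 A20 B20))|exact: (addr_ge0 B10 B20)|].
move=> X W S LL g HG tau X0 W1 SN gE g0 tau0 low up.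
have W0 : 0 < W := lt_le_trans ltr01 W1.
have tq := powR_ge0 tau (lam / (lam - 1)).
have yz : W `^ lam * W `^ (1 - lam) = W.
  by rewrite -powR_gt0D // addrC subrK powRr1 // ltW.
have yt : W `^ lam * W `^ (lam / 2) = W `^ (3 * lam / 2).
  by rewrite -powR_gt0D //; congr (_ `^ _); field.
have tt : (W `^ (lam / 2)) ^+ 2 = W `^ lam.
  by rewrite expr2 -powR_gt0D //; congr (_ `^ _); field.
have zz : (W `^ (1 - lam)) ^+ 2 = W `^ (2 * (1 - lam)).
  by rewrite expr2 -powR_gt0D //; congr (_ `^ _); ring.
case: (lerP (g + (delta - 1) * X) (2 * S)) => hE.
  have [gy WK] := small_diffusion_alg r0 N0 Cs0 C0 m0 d1 dl (powR_ge0 _ _) (powR_ge0 _ _)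
    (powR_ge0 _ _) yz yt X0 SN hE g0 tau0 (yK W W1) low up.
  have := dominated_power l1 l2 N0 r0 K0 W1 tau0 gy WK.
  rewrite -/A1 -/B1 => h; apply: le_trans h _; rewrite mulrDl; apply: lerD.
    by rewrite lerDl addr_ge0.
  by rewrite lerDl mulr_ge0.
have y1 := yK1 W W1; have y2 := yK2 W W1; have y3 := yK3 W W1.
rewrite -zz in y1; rewrite -tt in y2.
have hg := large_diffusion_alg r0 Cs0 C0 m0 d1 W1 X0 (ltW hE) g0 tau0 gE y1 y2 y3 low up.
have tau20 : 0 <= 2 / tau by rewrite divr_ge0 // ltW.
rewrite [2 * g / tau]mulrAC in hg.
have KK : 0 <= K1 + K2 + K3 by rewrite !addr_ge0.
have h := @quadratic_bound g D _ _ D0 KK tau20 g0 hg.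
have h2 : D * (2 / tau) <= D * 2 + D * 2 * tau `^ (lam / (lam - 1)).
  rewrite mulrA -[X in _ <= X + _]mulr1 -mulrDr ler_wpM2l //.
  exact: inv_le_powR.
have h3 : 0 <= B1 * tau `^ (lam / (lam - 1)) by rewrite mulr_ge0.
apply: le_trans h _; rewrite (mulrDl B1).
exact: (sum_le_split _ h2 h3 A10).
Qed.

End PointwiseBound.

(** * Bounds for the derivatives of the weight *)

Section WeightBounds.
Context {R : realType}.
Implicit Types lam s W : R.

Lemma dweight_le lam s W : 1 / 2 < lam -> 1 + s ^+ 2 <= W ->
  `|dweight lam s| <= 2 * lam * W `^ (lam - 1 / 2).
Proof.
move=> l1 sW; have y0 := one_sqr_gt0 s.
have l0 : 0 < lam by clear -l1; lra.
have l2 : 0 <= 2 * lam by rewrite mulr_ge0 // ltW.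
have s1 : `|s| <= (1 + s ^+ 2) `^ (1 / 2).
  rewrite mul1r (powR12_sqrt (ltW y0)) -sqrtr_sqr ler_sqrt; last exact: ltW.
  by rewrite lerDr.
rewrite /dweight normrM (ger0_norm (powR_ge0 _ _)) normrM (ger0_norm l2) -mulrA ler_wpM2l //.
apply: le_trans (ler_wpM2r (powR_ge0 _ _) s1) _.
rewrite -powR_gt0D //.
have -> : 1 / 2 + (lam - 1) = lam - 1 / 2 by field.
apply: ge0_ler_powR; rewrite ?nnegrE ?(ltW y0) //.
  by rewrite subr_ge0 ltW.
exact: le_trans (ltW y0) sW.
Qed.

Lemma powR_neg_le (a y W : R) : a <= 0 -> 0 < y -> y <= W -> W `^ a <= y `^ a.
Proof.
move=> a0 y0 yW; have W0 := lt_le_trans y0 yW.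
rewrite -[a]opprK powRN [leRHS]powRN lef_pV2 ?posrE ?powR_gt0 //.
by apply: ge0_ler_powR; rewrite ?nnegrE ?oppr_ge0 // ltW.
Qed.

(** With [(1 + s^2)^(lam-2)] factored out, the second derivative exceeds
    [2 lam (2 lam - 1) (1 + s^2)] by the constant [4 lam (1 - lam)]. Passing to [W] uses that the
    exponent [lam - 1] is negative. *)
Lemma ddweight_ge lam s W : 1 / 2 < lam -> lam < 1 -> 1 + s ^+ 2 <= W ->
  2 * (lam * (2 * lam - 1)) * W `^ (lam - 1) <= ddweight lam s.
Proof.
move=> l1 l2 sW; have y0 := one_sqr_gt0 s.
have e0 : 0 <= 2 * (lam * (2 * lam - 1)).
  by rewrite !mulr_ge0 //; clear -l1; lra.
have c0 : 0 <= 4 * lam * (1 - lam) by rewrite !mulr_ge0 //; clear -l1 l2; lra.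
apply: (@le_trans _ _ (2 * (lam * (2 * lam - 1)) * (1 + s ^+ 2) `^ (lam - 1))).
  by rewrite ler_wpM2l // powR_neg_le // subr_le0 ltW.
rewrite /ddweight.
have q0 : 0 <= (1 + s ^+ 2) `^ (lam - 1 - 1) := powR_ge0 _ _.
have -> : (1 + s ^+ 2) `^ (lam - 1) = (1 + s ^+ 2) `^ (lam - 1 - 1) * (1 + s ^+ 2).
  by rewrite -[X in _ * X](powRr1 (ltW y0)) -powR_gt0D // subrK.
move: (_ `^ _) q0 => q q0; rewrite -subr_ge0.
have -> : 2 * lam * (q * (1 + s ^+ 2)) + 4 * lam * (lam - 1) * s ^+ 2 * q -
  2 * (lam * (2 * lam - 1)) * (q * (1 + s ^+ 2)) = 4 * lam * (1 - lam) * q by ring.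
exact: mulr_ge0.
Qed.

Lemma norm_le_sqrt_sum (I : finType) (F : I -> R) i :
  `|F i| <= Num.sqrt (\sum_i F i ^+ 2).
Proof.
rewrite -sqrtr_sqr ler_sqrt; last by apply: sumr_ge0 => j _; exact: sqr_ge0.
by rewrite (bigD1 i) //= lerDl; apply: sumr_ge0 => j _; exact: sqr_ge0.
Qed.

Lemma norm_le_sqrt_sum2 (I J : finType) (F : I -> J -> R) i j :
  `|F i j| <= Num.sqrt (\sum_i \sum_j F i j ^+ 2).
Proof.
rewrite pair_big /=.
exact: (@norm_le_sqrt_sum (I * J)%type (fun ij => F ij.1 ij.2) (i, j)).
Qed.

End WeightBounds.

Lemma evolution_assembly (R : realType) (g G LL b1 b2 wGZ z y S a1 a2 a3 : R) :
  g <= G -> LL + b1 + b2 <= G + wGZ -> wGZ <= z -> y <= S ->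
  a1 - a2 - a3 <= g + b1 + b2 + (y - z) -> LL + a1 - a2 - a3 <= 2 * G + S.
Proof. lra. Qed.

(** * The lower bound for the evolution at one point *)

Section PointwiseEvolution.
Context {R : realType}.
Variables (d : nat) (lam rho1 rho2 kappa B : R).

Definition gradient_const : R := lam * (2 * lam - 1).

(* The coefficient of [X W^(1-lam)]; it must not depend on [B], since
   [delta0] may not depend on the structure functions. *)
Definition diffusion_const : R :=
  kappa / gradient_const + 2 * (#|'I_d|%:R * #|'I_d|%:R) ^+ 2 / gradient_const.

(** The commutators of [L] with the [Y_al] occur twice: in [nu * Gamma2Z], with factor
    [gradient_const], and multiplied by the first derivative of the weight, with factor
    [2 * lam]. *)
Definition commutator_const : R :=
  (gradient_const + 2 * lam) * (#|Lam d|%:R * comm_const d B).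

(** Bounds the drift terms [2 sum (e_j f) [e_j, Y_al] f] multiplied by the first derivative of the
    weight. *)
Definition torsion_const : R :=
  4 * lam * (#|Lam d|%:R * (#|'I_d|%:R * cross_const d B)).

Definition lower_order_const : R :=
  `|rho1| + rho2 + #|'I_d|%:R * #|'I_d|%:R + commutator_const ^+ 2
   + commutator_const ^+ 2 / (2 * gradient_const) + 2 * commutator_const
   + 2 * torsion_const.

Context {n : nat} {M : topologicalType}.
Variables (A : set (chart R n M)) (e : 'I_d -> (M -> R) -> (M -> R)).
Hypothesis de : forall j, derivation A (e j).
Variables (a : idx4 d -> 'I_d -> M -> R) (b : idx4 d -> idx2 d -> M -> R)
  (c : idx4 d -> idx3 d -> M -> R).
Hypotheses (sa : forall q k, smooth A (a q k)) (sb : forall q k, smooth A (b q k))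
  (sc : forall q k, smooth A (c q k)).
Hypothesis habc : bracket4_expansion A e a b c.
Variable p : M.
Hypotheses (aB : forall q k, `|a q k p| <= B) (bB : forall q k, `|b q k p| <= B)
  (cB : forall q k, `|c q k p| <= B)
  (daB : forall j q k, `|e j (a q k) p| <= B) (dbB : forall j q k, `|e j (b q k) p| <= B)
  (dcB : forall j q k, `|e j (c q k) p| <= B).
Hypothesis B0 : 0 <= B.
Hypotheses (l1 : 1 / 2 < lam) (l2 : lam < 1) (r0 : 0 <= rho2).
Variable m : R.
Hypothesis hCD : CD A e rho1 rho2 kappa m.
Variables f v : M -> R.
Hypotheses (sf : smooth A f) (sv : smooth A v).
Hypothesis vE : forall p, v p = L e f p + Gamma e f p.

Lemma lam_gt0 : 0 < lam.
Proof. by apply: lt_trans l1; rewrite divr_gt0. Qed.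

Lemma gradient_const_gt0 : 0 < gradient_const.
Proof.
apply: mulr_gt0; first exact: lam_gt0.
by rewrite subr_gt0 mulrC -ltr_pdivrMr.
Qed.

Lemma comm_const_ge0 : 0 <= comm_const d B.
Proof. exact: (mulr_ge0 (mulr_ge0 (ler0n _ 4) (ler0n _ _)) (sqr_ge0 _)). Qed.

Lemma commutator_const_ge0 : 0 <= commutator_const.
Proof.
have l0 : 0 <= 2 * lam := mulr_ge0 (ler0n _ 2) (ltW lam_gt0).
apply: mulr_ge0; first exact: (addr_ge0 (ltW gradient_const_gt0) l0).
exact: (mulr_ge0 (ler0n _ _) comm_const_ge0).
Qed.

Lemma cross_const_ge0 : 0 <= cross_const d B.
Proof. exact: le_trans ler01 (@cross_const_ge1 R d B B0). Qed.

Lemma torsion_const_ge0 : 0 <= torsion_const.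
Proof.
have l0 : 0 <= 4 * lam := mulr_ge0 (ler0n _ 4) (ltW lam_gt0).
exact: (mulr_ge0 l0 (mulr_ge0 (ler0n _ _) (mulr_ge0 (ler0n _ _) cross_const_ge0))).
Qed.

Lemma li_yau_evolution delta X W :
  X = Gamma e f p -> W = 1 + \sum_al Y e al f p ^+ 2 ->
  m^-1 * L e f p ^+ 2 + rho2 * W - diffusion_const * (X * W `^ (1 - lam))
    - lower_order_const * (X * W `^ (lam / 2) + W `^ (3 * lam / 2))
  <= drift_laplacian e f (harnack e f v lam delta) p - harnack_dt e f v lam delta p.
Proof.
move=> XE WE; rewrite (harnack_evolution de sf sv vE).
have l0 := lam_gt0.
have eps0 := gradient_const_gt0.
have sq0 (I : finType) (F : I -> R) : 0 <= \sum_i F i ^+ 2.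
  by apply: sumr_ge0 => i _; exact: sqr_ge0.
have W1 : 1 <= W by rewrite WE lerDl.
have W0 : 0 < W := lt_le_trans ltr01 W1.
have X0 : 0 <= X by rewrite XE GammaE.
pose x : R := Num.sqrt X; pose r : R := Num.sqrt W.
pose Q := \sum_(i < d) \sum_(j < d) e j (e i f) p ^+ 2.
pose KK := \sum_al \sum_(j < d) e j (Y e al f) p ^+ 2.
have Q0 : 0 <= Q by apply: sumr_ge0 => i _.
have KK0 : 0 <= KK by apply: sumr_ge0 => i _.
pose h : R := Num.sqrt Q; pose k : R := Num.sqrt KK.
have x0 : 0 <= x := sqrtr_ge0 _. have h0 : 0 <= h := sqrtr_ge0 _.
have k0 : 0 <= k := sqrtr_ge0 _. have rr0 : 0 <= r := sqrtr_ge0 _.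
have x2 : x ^+ 2 = X by rewrite sqr_sqrtr.
have r2 : r ^+ 2 = W by rewrite sqr_sqrtr // ltW.
have h2 : h ^+ 2 = Q by rewrite sqr_sqrtr.
have k2 : k ^+ 2 = KK by rewrite sqr_sqrtr.
have xb j : `|e j f p| <= x.
  by rewrite /x XE GammaE; exact: (norm_le_sqrt_sum (fun j => e j f p) j).
have wb al : `|Y e al f p| <= r.
  apply: le_trans (norm_le_sqrt_sum (fun al => Y e al f p) al) _.
  by rewrite ler_sqrt ?(ltW W0) // WE lerDr.
have hb i j : `|e i (e j f) p| <= h.
  exact: (norm_le_sqrt_sum2 (fun i j => e j (e i f) p) j i).
have kb j al : `|e j (Y e al f) p| <= k.
  exact: (norm_le_sqrt_sum2 (fun al j => e j (Y e al f) p) al j).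
have cr := @cross_le R n d M A e a b c habc p B aB bB cB B0 f sf x r x0 rr0 xb wb.
have cY := @commutator_Y_le R n d M A e de a b c sa sb sc habc p B aB bB cB daB dbB dcB B0 f sf
  x r h k x0 rr0 h0 k0 xb wb hb kb.
have ce := @commutator_e_le R n d M A e de p f sf r k wb kb.
pose P := W `^ (lam - 1 / 2); pose T := W `^ (lam / 2).
have rE : r = W `^ (1 / 2) by rewrite mul1r (powR12_sqrt (ltW W0)).
have PrE : P / r = W `^ (lam - 1).
  by rewrite rE -powRN -powR_gt0D //; congr (_ `^ _); field.
have rPE : r / P = W `^ (1 - lam).
  by rewrite rE -powRN -powR_gt0D //; congr (_ `^ _); field.
have T2 : T ^+ 2 = P * r.
  by rewrite rE expr2 -!powR_gt0D //; congr (_ `^ _); field.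
have T3 : T ^+ 3 = W `^ (3 * lam / 2).
  by rewrite exprS expr2 -!powR_gt0D //; congr (_ `^ _); field.
have P1 : 1 <= P.
  by rewrite -[leLHS](powRr0 W); apply: ler_powR => //; rewrite subr_ge0 ltW.
have PT : P <= T.
  apply: ler_powR => //; rewrite -subr_ge0.
  have -> : lam / 2 - (lam - 1 / 2) = (1 - lam) / 2 by field.
  by rewrite divr_ge0 // subr_ge0 ltW.
have r1 : 1 <= r by rewrite -[leLHS]sqrtr1 ler_sqrt // ltW.
have rgt0 : 0 < r := lt_le_trans ltr01 r1.
have Pgt0 : 0 < P := lt_le_trans ltr01 P1.
pose D : R := #|'I_d|%:R; pose N : R := #|Lam d|%:R.
have D0 : 0 <= D := ler0n _ _. have N0 : 0 <= N := ler0n _ _.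
pose C1 := cross_const d B; pose C2 := comm_const d B.
have C10 : 0 <= C1 := cross_const_ge0. have C20 : 0 <= C2 := comm_const_ge0.
pose eps := gradient_const.
pose SS := x + r + h + k.
have SS0 : 0 <= SS by rewrite !addr_ge0.
have i1 : h ^+ 2 - D * D * x * (2 * k + r) <= Gamma2 e f p.
  rewrite (Gamma2E de) // -/Q h2 lerD2l lerNl.
  apply: le_trans (ler_norm _) _; rewrite normrN.
  have -> : D * D * x * (2 * k + r) = D * (x * (D * (2 * k + r))) by ring.
  by apply: norm_sum_le_card => i; apply: norm_mul_le.
have nu0 : 0 < eps * (P / r) by rewrite mulr_gt0 ?divr_gt0.
have i2 := hCD sf nu0 p.
(* An upper bound is wanted here, because CD has [nu * Gamma2Z] on its larger side and it must be
   moved across. *)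
have i3 : Gamma2Z e f p <= k ^+ 2 + N * (r * (C2 * SS)).
  rewrite (Gamma2ZE de) // -/KK k2 lerD2l.
  apply: le_trans (ler_norm _) _.
  by apply: norm_sum_le_card => al; apply: norm_mul_le.
have sW al : 1 + Y e al f p ^+ 2 <= W.
  rewrite WE lerD2l (bigD1 al) //= lerDl.
  by apply: sumr_ge0 => i _; exact: sqr_ge0.
have i4 : 2 * eps * (P / r) * k ^+ 2
    - N * ((2 * lam * P) * (C2 * SS + 2 * (D * (x * (C1 * (x + r))))))
  <= \sum_al (dweight lam (Y e al f p) *
             (L e (Y e al f) p - Y e al (L e f) p
              + 2 * \sum_(j < d) e j f p * bracket (e j) (Y e al) f p)
           + ddweight lam (Y e al f p) * \sum_(j < d) e j (Y e al f) p ^+ 2).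
  rewrite big_split [leRHS]addrC; apply: lerD; last first.
    rewrite lerNl; apply: le_trans (ler_norm _) _; rewrite normrN.
    apply: norm_sum_le_card => al; apply: norm_mul_le.
      exact: (dweight_le l1 (sW al)).
    apply: le_trans (ler_normD _ _) _; apply: lerD; first exact: cY.
    rewrite normrM ger0_norm // ler_wpM2l //.
    by apply: norm_sum_le_card => j; apply: norm_mul_le => //; exact: cr.
  rewrite k2 mulr_sumr; apply: ler_sum => al _; rewrite ler_wpM2r //.
  by rewrite PrE; exact: (ddweight_ge l1 l2 (sW al)).
have gz : GammaZ e f p = r ^+ 2 - 1 by rewrite GammaZE r2 WE addrAC subrr add0r.
rewrite gz -XE in i2.
have i3' := ler_wpM2l (ltW nu0) i3.
have alg := @evolution_algebra R x r h k P T eps commutator_const torsion_const (D * D) kappa rho1 rho2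
  x0 r1 P1 PT T2 eps0 commutator_const_ge0 torsion_const_ge0 (mulr_ge0 D0 D0) r0.
rewrite -/(lower_order_const) -/(diffusion_const) in alg.
rewrite -T3 -/T -rPE -x2 -r2.
rewrite -x2 in i2.
have nr : r != 0 by rewrite gt_eqF.
(* Of the [2 * eps] supplied by the weight one [eps] pays for [nu * Gamma2Z]; the other is left for
   [evolution_algebra]. *)
have key : eps * (P / r) * k ^+ 2 - commutator_const * P * (x + r + h + k)
    - torsion_const * P * x * (x + r)
  = 2 * eps * (P / r) * k ^+ 2
    - N * (2 * lam * P * (C2 * SS + 2 * (D * (x * (C1 * (x + r))))))
    - eps * (P / r) * (k ^+ 2 + N * (r * (C2 * SS))).
  rewrite /commutator_const /torsion_const -/eps -/C1 -/C2 -/N -/D /SS.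
  by field.
apply: (evolution_assembly i1 i2 i3' i4).
rewrite -key; apply: le_trans alg _.
by rewrite !addrA.
Qed.

End PointwiseEvolution.

Lemma is_derive_bigsum (R : realType) (I : Type) (r : seq I) (F : I -> R -> R)
    (dF : I -> R) (t : R) :
  (forall i, is_derive t (1 : R) (F i) (dF i)) ->
  is_derive t (1 : R) (fun s => \sum_(i <- r) F i s) (\sum_(i <- r) dF i).
Proof.
move=> D; elim: r => [|i r IH].
  rewrite big_nil; have -> : (fun s => \sum_(i <- [::]) F i s) = cst 0.
    by apply/funext => s; rewrite big_nil.
  exact: is_derive_cst.
rewrite big_cons; have -> : (fun s => \sum_(j <- i :: r) F j s)
    = F i + (fun s => \sum_(j <- r) F j s).
  by apply/funext => s; rewrite big_cons.
exact: is_deriveD.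
Qed.

(** * Commutation with the time derivative and the equation for [ln u] *)

Section SpacetimeOperators.
Context {R : realType} {n : nat} {M : topologicalType}.
Variable A : set (chart R n M).
Hypothesis atlasA : smooth_atlas A.
Implicit Types (F : M -> R -> R) (X Z : (M -> R) -> (M -> R)).

(** The analogue of [derivation] for the time variable: proved in charts for vector fields, then
    passed to brackets by algebra, which reaches all the [Y_al]. *)
Record st_operator X : Prop := StOperator {
  st_op_smooth : forall F, st_smooth A F -> st_smooth A (fun p t => X (F ^~ t) p);
  st_op_dt : forall F p t, st_smooth A F -> 0 < t ->
    derive1 (fun s => X (F ^~ s) p) t = X (fun q => derive1 (F q) t) p }.

Lemma vector_field_st_operator X : vector_field A X -> st_operator X.
Proof.
by move=> vX; split=> [F|F p t sF t0]; [exact: st_act|exact: (dt_act atlasA vX p sF t0)].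
Qed.

Lemma st_sub F F' : st_smooth A F -> st_smooth A F' ->
  st_smooth A (fun p t => F p t - F' p t).
Proof.
move=> sF sF'.
have -> : (fun p t => F p t - F' p t) = (fun p t => F p t + -1 * F' p t).
  by apply/funext => p; apply/funext => t; rewrite mulN1r.
by apply: stD => //; apply: stM => //; exact: st_cst.
Qed.

Lemma st_is_derive F p (t : R) : st_smooth A F -> 0 < t ->
  is_derive t (1 : R) (F p) (derive1 (F p) t).
Proof.
move=> sF t0; rewrite derive1E; apply: derivableP; exact: (st_derivable_time atlasA sF t0).
Qed.

Lemma bracket_st_operator X Z : st_operator X -> st_operator Z ->
  st_operator (bracket X Z).
Proof.
move=> [sX dX] [sZ dZ].
have sXZ F : st_smooth A F -> st_smooth A (fun p t => X (Z (F ^~ t)) p).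
  by move=> sF; exact: (sX _ (sZ _ sF)).
have sZX F : st_smooth A F -> st_smooth A (fun p t => Z (X (F ^~ t)) p).
  by move=> sF; exact: (sZ _ (sX _ sF)).
split=> [F sF|F p t sF t0]; first by apply: st_sub; [exact: sXZ|exact: sZX].
have [_ E] := is_deriveB (st_is_derive p (sXZ F sF) t0) (st_is_derive p (sZX F sF) t0).
rewrite derive1E [LHS]E /bracket (dX _ _ _ (sZ _ sF)) // (dZ _ _ _ (sX _ sF)) //.
congr (_ - _); first exact: (@operator_ext _ _ X _ _ p (fun q => dZ F q t sF t0)).
exact: (@operator_ext _ _ Z _ _ p (fun q => dX F q t sF t0)).
Qed.

Lemma Y_st_operator d (e : 'I_d -> (M -> R) -> (M -> R)) al :
  (forall j, st_operator (e j)) -> st_operator (Y e al).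
Proof.
move=> oe; case: al => [[i j]|[[i j] k]]; first exact: bracket_st_operator.
by apply: bracket_st_operator => //; exact: bracket_st_operator.
Qed.

Lemma is_derive_weight lam (s : R) : is_derive s (1 : R) (weight lam) (dweight lam s).
Proof.
have h1 : is_derive s (1 : R) (fun s : R => 1 + s ^+ 2) (2 * s).
  have := is_deriveD (is_derive_cst (1 : R) s (1 : R)) (is_deriveX 2 (is_derive_id s (1 : R))).
  by rewrite add0r expr1 [X in is_derive _ _ _ X]mulr1 -[_ *+ 2]mulr_natl.
have h2 := @is_derive1_powR R lam (1 + s ^+ 2) (one_sqr_gt0 s).
have := @is_derive1_comp R (fun y : R => y `^ lam) (fun s : R => 1 + s ^+ 2) s _ _ h2 h1.
have -> // : lam * (1 + s ^+ 2) `^ (lam - 1) * (2 * s) = dweight lam s.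
by rewrite /dweight; ring.
Qed.

Section LogSolution.
Variables (d : nat) (e : 'I_d -> (M -> R) -> (M -> R)).
Hypothesis ve : forall j, vector_field A (e j).
Variable f : M -> R -> R.
Hypothesis sf : st_smooth A f.
Hypothesis heat : forall p t, 0 < t ->
  derive1 (f p) t = L e (f ^~ t) p + Gamma e (f ^~ t) p.

Let oe j : st_operator (e j). Proof. exact: vector_field_st_operator. Qed.
Let oY al : st_operator (Y e al). Proof. exact: Y_st_operator. Qed.
Let sej j : st_smooth A (fun p t => e j (f ^~ t) p). Proof. exact: (st_op_smooth (oe j)). Qed.
Let sYal al : st_smooth A (fun p t => Y e al (f ^~ t) p).
Proof. exact: (st_op_smooth (oY al)). Qed.

Definition st_harnack lam delta p t :=
  harnack e (f ^~ t) (fun q => derive1 (f q) t) lam delta p.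

Lemma st_harnack_smooth lam delta : st_smooth A (st_harnack lam delta).
Proof.
have sG : st_smooth A (fun p t => Gamma e (f ^~ t) p).
  have -> : (fun p t => Gamma e (f ^~ t) p) = (fun p t => \sum_(j < d) e j (f ^~ t) p * e j (f ^~ t) p).
    by apply/funext => p; apply/funext => t; rewrite GammaE.
  by apply: st_sum => j _; exact: stM.
apply: st_sub; last by apply: stM; [exact: st_cst|exact: st_dt].
apply: stD => //; apply: (@st_sum _ _ _ _ _ _ _ (fun al p t => weight lam (Y e al (f ^~ t) p))) => al _.
apply: (@st_powR _ _ _ A (fun p t => 1 + Y e al (f ^~ t) p ^+ 2) lam).
  by move=> p t _; exact: one_sqr_gt0.
by apply: stD; [exact: st_cst|exact: stM].
Qed.

Lemma is_derive_Gamma p (t : R) : 0 < t ->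
  is_derive t (1 : R) (fun s => Gamma e (f ^~ s) p)
    (2 * \sum_(j < d) e j (f ^~ t) p * e j (fun q => derive1 (f q) t) p).
Proof.
move=> t0.
have D j : is_derive t (1 : R) (fun s => e j (f ^~ s) p) (e j (fun q => derive1 (f q) t) p).
  by rewrite -(st_op_dt (oe j) _ sf t0); exact: (st_is_derive p (sej j) t0).
have D2 j := is_deriveX 2 (D j).
have := is_derive_sum D2.
have -> : \sum_(j < d) (fun s => e j (f ^~ s) p) ^+ 2 = (fun s => Gamma e (f ^~ s) p).
  by apply/funext => s; rewrite GammaE fct_sumE.
move/is_derive_eq; apply; rewrite mulr_sumr; apply: eq_bigr => j _.
by rewrite expr1 scale_regularE -[_ *+ 2]mulr_natl mulrA.
Qed.

(** Differentiating the equation [f_t = L f + Gamma f] in time gives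
    [f_tt = L f_t + 2 sum (e_j f) (e_j f_t)], that is, [cL f_t = 0]. *)
Lemma is_derive_dtf p (t : R) : 0 < t ->
  is_derive t (1 : R) (derive1 (f p))
    (drift_laplacian e (f ^~ t) (fun q => derive1 (f q) t) p).
Proof.
move=> t0.
have D j : is_derive t (1 : R) (fun s => e j (e j (f ^~ s)) p)
    (e j (e j (fun q => derive1 (f q) t)) p).
  have := st_is_derive p (st_op_smooth (oe j) (sej j)) t0.
  rewrite (st_op_dt (oe j) _ (sej j) t0) => /is_derive_eq; apply.
  exact: (@operator_ext _ _ (e j) _ _ p (fun q => st_op_dt (oe j) q sf t0)).
have DL := is_derive_sum D.
have := is_deriveD DL (is_derive_Gamma p t0).
apply: near_eq_is_derive; apply: (near_open_eq (@open_gt R 0) t0) => s s0.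
by rewrite heat // fct_sumE.
Qed.

Lemma st_harnack_dt lam delta p t : 0 < t ->
  derive1 (st_harnack lam delta p) t =
  harnack_dt e (f ^~ t) (fun q => derive1 (f q) t) lam delta p.
Proof.
move=> t0.
have D al : is_derive t (1 : R) (weight lam \o (fun s => Y e al (f ^~ s) p))
    (dweight lam (Y e al (f ^~ t) p) * Y e al (fun q => derive1 (f q) t) p).
  apply: (@is_derive1_comp R (weight lam) (fun s => Y e al (f ^~ s) p)).
    exact: is_derive_weight.
  by rewrite -(st_op_dt (oY al) _ sf t0); exact: (st_is_derive p (sYal al) t0).
have DS := is_derive_bigsum (index_enum (Lam d)) D.
have DD := is_deriveB (is_deriveD (is_derive_Gamma p t0) DS)
   (is_deriveZ delta (is_derive_dtf p t0)).
have E : st_harnack lam delta p = (fun s => Gamma e (f ^~ s) p) +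
    (fun s => \sum_al weight lam (Y e al (f ^~ s) p)) - delta \*: derive1 (f p).
  by [].
by rewrite derive1E E; have [_ ->] := DD.
Qed.

End LogSolution.
End SpacetimeOperators.

(** Each [e_j] is applied once more to [e_j w = w * e_j (ln w)]. This turns the linear heat equation
    for [u] into the equation for [ln u]. *)
Lemma log_laplacian (R : realType) n d (M : topologicalType) (A : set (chart R n M))
    (e : 'I_d -> (M -> R) -> (M -> R)) (w : M -> R) p :
  (forall j, derivation A (e j)) -> smooth A w -> (forall q, 0 < w q) ->
  L e (fun q => ln (w q)) p + Gamma e (fun q => ln (w q)) p = (w p)^-1 * L e w p.
Proof.
move=> de sw w0; have sl := smooth_ln w0 sw.
rewrite GammaE /L mulr_sumr -big_split /=; apply: eq_bigr => j _.
have sel : smooth A (e j (fun q => ln (w q))) by exact: der_smooth.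
have E q : e j w q = w q * e j (fun q => ln (w q)) q.
  by rewrite (der_ln (de j)) // mulVKf // gt_eqF.
rewrite (@operator_ext _ _ (e j) _ _ p E) (derM (de j)) // E.
have nw : w p != 0 by rewrite gt_eqF.
by field.
Qed.

(** * Finiteness of the suprema of the structure functions *)

Section Suprema.
Context {R : realType} {n : nat} {M : topologicalType}.
Variable A : set (chart R n M).
Hypotheses (atlasA : smooth_atlas A) (cM : compact [set: M]).

Lemma smooth_family_bounded (I : finType) (F : I -> M -> R) (p0 : M) :
  (forall i, smooth A (F i)) -> exists K, forall i p, `|F i p| <= K.
Proof.
move=> sF.
have /choice[K FK] i : exists K, forall p, `|F i p| <= K.
  have cF : {within [set: M], continuous (fun p => `|F i p|)}.
    apply: continuous_subspaceT => p; apply: (@continuous_comp _ _ _ (F i) Num.norm).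
      exact: (smooth_continuous atlasA (sF i)).
    exact: norm_continuous.
  have M0 : [set: M] !=set0 by exists p0.
  have [q _ H] := compact_EVT_max M0 cM cF.
  by exists `|F i q| => p; apply: H; rewrite inE.
exists (\sum_i `|K i|) => i p; apply: le_trans (FK i p) _.
by apply: le_trans (ler_norm _) _; rewrite (bigD1 i) //= lerDl sumr_ge0.
Qed.

(** The real [sup] has a default value on unbounded sets, so it bounds its members only once
    boundedness is known; here that comes from compactness of [M] and finiteness of the index
    sets. *)
Lemma sup_coef_ge (I J : finType) (F : I -> J -> M -> R) i j p :
  (forall i j, smooth A (F i j)) -> `|F i j p| <= sup_coef F.
Proof.
move=> sF; apply: ub_le_sup; last by exists i, j, p.
have [K FK] := @smooth_family_bounded (I * J)%type (fun ij => F ij.1 ij.2) p (fun ij => sF _ _).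
by exists K => _ [i' [j' [p' ->]]]; exact: (FK (i', j') p').
Qed.

Lemma sup_dcoef_ge d (e : 'I_d -> (M -> R) -> (M -> R)) (I J : finType)
    (F : I -> J -> M -> R) k i j p : (forall j, derivation A (e j)) ->
  (forall i j, smooth A (F i j)) -> `|e k (F i j) p| <= sup_dcoef e F.
Proof.
move=> de sF; apply: ub_le_sup; last by exists k, i, j, p.
have sE (kij : 'I_d * I * J) : smooth A (e kij.1.1 (F kij.1.2 kij.2)).
  by apply: der_smooth.
have [K FK] := @smooth_family_bounded ('I_d * I * J)%type
  (fun kij => e kij.1.1 (F kij.1.2 kij.2)) p sE.
by exists K => _ [k' [i' [j' [p' ->]]]]; exact: (FK (k', i', j') p').
Qed.

End Suprema.

(** * The parabolic maximum principle *)

Lemma derive_ge0_at_left_max (R : realType) (h : R -> R) (s t d : R) : s < t ->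
  is_derive t (1 : R) h d -> (forall r, s < r -> r <= t -> h r <= h t) -> 0 <= d.
Proof.
move=> st dh hmax; rewrite leNgt; apply/negP => d0.
(* The maximum in time may sit at the final time, so only times before [t] are available. Reflection
   through [k |-> t - k] turns left quotients into right ones. *)
have dr : is_derive (0 : R) (1 : R) (fun k : R => t - k) (-1).
  have := is_deriveB (is_derive_cst t (0 : R) (1 : R)) (is_derive_id (0 : R) (1 : R)).
  by rewrite sub0r.
have dh0 : is_derive (t - 0) (1 : R) h d by rewrite subr0.
have [dq E] := @is_derive1_comp R h (fun k : R => t - k) 0 d (-1) dh0 dr.
have d20 : 0 < - d / 2 by rewrite divr_gt0 // oppr_gt0.
have N1 := near_difference_quotient dq d20.
have st0 : 0 < t - s by rewrite subr_gt0.
have N2 := nbhs_right_lt st0.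
have N3 := nbhs_right_gt (0 : R).
have [k [[/= Q ks] k0]] := filter_ex (filterI (filterI N1 N2) N3).
move: Q; rewrite E [(k *: 1 : R)]mulr1 addr0 subr0 => Q.
have hk : h (t - k) - h t <= 0.
  by rewrite subr_le0; apply: hmax; [rewrite ltrBrDl -ltrBrDr|rewrite lerBlDr lerDl ltW].
have qk : k^-1 *: (h (t - k) - h t) <= 0 by rewrite scale_regularE mulr_ge0_le0 // invr_ge0 ltW.
move: Q qk; rewrite mulrN1; move: (_ *: _) => q.
rewrite ler_norml => /andP[Q _] q0; move: Q q0 d0; clear; lra.
Qed.

Section ParabolicMaximum.
Context {R : realType} {n d : nat} {M : topologicalType}.
Variables (A : set (chart R n M)) (e : 'I_d -> (M -> R) -> (M -> R)).
Hypotheses (atlasA : smooth_atlas A) (cM : compact [set: M]).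
Hypothesis ve : forall j, vector_field A (e j).

Lemma drift_laplacian_at_max (f g : M -> R) p : smooth A g -> (forall q, g q <= g p) ->
  drift_laplacian e f g p <= 0.
Proof.
move=> sg gp; rewrite /drift_laplacian [X in _ + 2 * X]big1 => [|j _].
  rewrite mulr0 addr0 /L -oppr_ge0 -sumrN; apply: sumr_ge0 => j _; rewrite oppr_ge0.
  exact: (vector_field_at_max atlasA (ve j) sg gp).2.
by rewrite (vector_field_at_max atlasA (ve j) sg gp).1 mulr0.
Qed.

(* The weight [(t - s)^2] forces the maximum away from the initial time. *)
Lemma parabolic_maximum (G : M -> R -> R) (s T : R) p : 0 < s -> s < T ->
  st_smooth A G -> 0 < G p T ->
  exists q t, [/\ s < t, t <= T, 0 < G q t,
    (T - s) ^+ 2 * G p T <= (t - s) ^+ 2 * G q t &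
    forall f, drift_laplacian e f (G ^~ t) q - derive1 (G q) t <= 2 * G q t / (t - s)].
Proof.
move=> s0 sT sG GT0.
pose K : set (M * R) := [set: M] `*` [set` `[s, T]].
pose H (z : M * R) := (z.2 - s) ^+ 2 * G z.1 z.2.
have cK : compact K by apply: compact_setX => //; exact: segment_compact.
have K0 : K !=set0 by exists (p, T); split => //=; rewrite in_itv /= lexx ltW.
have cH : {within K, continuous H}.
  apply: continuous_in_subspaceT => -[q t]; rewrite inE => -[_ /=].
  rewrite in_itv /= => /andP[st _].
  have t0 : 0 < t := lt_le_trans s0 st.
  apply: (@cvgM _ _ (nbhs (q, t)) _ (fun z : M * R => (z.2 - s) ^+ 2) (fun z => G z.1 z.2)).
    have c2 : (fun z : M * R => z.2 - s) @ (q, t) --> t - s.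
      by apply: cvgB; [exact: cvg_snd|exact: cvg_cst].
    exact: (cvgM c2 c2).
  exact: (@st_continuous _ _ _ _ atlasA G q t sG t0).
have [[q t]] := compact_EVT_max K0 cK cH.
rewrite inE => -[_ /=]; rewrite in_itv /= => /andP[st tT] Hmax.
have Hm q' t' : s <= t' -> t' <= T -> (t' - s) ^+ 2 * G q' t' <= (t - s) ^+ 2 * G q t.
  move=> st' t'T; apply: (Hmax (q', t')); rewrite inE; split => //=.
  by rewrite in_itv /= st' t'T.
have HT := Hm p T (ltW sT) (lexx T).
have Hpos : 0 < (t - s) ^+ 2 * G q t.
  by apply: lt_le_trans HT; rewrite mulr_gt0 // exprn_gt0 // subr_gt0.
have stlt : s < t.
  rewrite lt_neqAle st andbT; apply/eqP => E.
  by move: Hpos; rewrite E subrr expr0n /= mul0r ltxx.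
have t0 : 0 < t := lt_trans s0 stlt.
have ts0 : 0 < t - s by rewrite subr_gt0.
have ts20 : 0 < (t - s) ^+ 2 by rewrite exprn_gt0.
have G0 : 0 < G q t by move: Hpos; rewrite pmulr_rgt0.
exists q, t; split => // f.
have D1 : drift_laplacian e f (G ^~ t) q <= 0.
  apply: drift_laplacian_at_max; first exact: st_slice.
  by move=> q'; have := Hm q' t st tT; rewrite ler_pM2l.
have dG := st_is_derive atlasA q sG t0.
have d1 : is_derive t (1 : R) (fun r : R => r - s) 1.
  have := is_deriveB (is_derive_id t (1 : R)) (is_derive_cst s t (1 : R)).
  by rewrite subr0.
have dH := is_deriveM (is_deriveX 2 d1) dG.
have D2 := derive_ge0_at_left_max stlt dH _.
(* The time derivative of the weighted function at its maximum; the second summand, divided by the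
   weight, is the right-hand side [2 G / (t - s)]. *)
have : 0 <= (t - s) ^+ 2 * derive1 (G q) t + G q t * (2 * (t - s)).
  have -> : (t - s) ^+ 2 * derive1 (G q) t + G q t * (2 * (t - s)) =
    ((fun r : R => r - s) ^+ 2) t *: derive1 (G q) t
      + G q t *: ((2%:R * (t - s) ^+ 2.-1) *: (1 : R)).
    by rewrite !scale_regularE expr1 mulr1.
  apply: D2 => r sr rt; exact: (Hm q r (ltW sr) (le_trans rt tT)).
have -> : (t - s) ^+ 2 * derive1 (G q) t + G q t * (2 * (t - s)) =
   (t - s) ^+ 2 * (derive1 (G q) t + 2 * G q t / (t - s)).
  by field; rewrite gt_eqF.
rewrite pmulr_rge0 // => D3.
by move: D1 D3; move: (drift_laplacian _ _ _ _) (derive1 _ _) (_ / _) => u w y *; lra.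
Qed.

End ParabolicMaximum.

(** * The estimate for the Harnack quantity of [ln u] *)

Section HarnackEstimate.
Context {R : realType} {n d : nat} {M : topologicalType}.
Variables (A : set (chart R n M)) (e : 'I_d -> (M -> R) -> (M -> R)).
Hypotheses (atlasA : smooth_atlas A) (cM : compact [set: M]).
Hypothesis ve : forall j, vector_field A (e j).
Variables (a : idx4 d -> 'I_d -> M -> R) (b : idx4 d -> idx2 d -> M -> R)
  (c : idx4 d -> idx3 d -> M -> R).
Hypotheses (sa : forall q k, smooth A (a q k)) (sb : forall q k, smooth A (b q k))
  (sc : forall q k, smooth A (c q k)).
Hypothesis habc : bracket4_expansion A e a b c.
Variable B : R.
Hypotheses (aB : sup_coef a <= B) (bB : sup_coef b <= B) (cB : sup_coef c <= B)
  (daB : sup_dcoef e a <= B) (dbB : sup_dcoef e b <= B) (dcB : sup_dcoef e c <= B).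
Hypothesis B0 : 0 <= B.
Variables lam rho1 rho2 kappa m delta : R.
Hypotheses (l1 : 1 / 2 < lam) (l2 : lam < 2 / 3) (r0 : 0 <= rho2).
Hypothesis hCD : CD A e rho1 rho2 kappa m.
Variable f : M -> R -> R.
Hypothesis sf : st_smooth A f.
Hypothesis heat : forall p t, 0 < t ->
  derive1 (f p) t = L e (f ^~ t) p + Gamma e (f ^~ t) p.

Variables K1 K2 : R.
Hypotheses (K10 : 0 <= K1) (K20 : 0 <= K2).
(* The conclusion of [evolution_bound]. *)
Hypothesis evolution_le : forall X W S LL g HG tau : R,
  0 <= X -> 1 <= W -> S <= (#|Lam d|%:R + 1) * W `^ lam -> g = X + S - delta * (LL + X) ->
  0 < g -> 0 < tau ->
  m^-1 * LL ^+ 2 + rho2 * W - diffusion_const d lam kappa * (X * W `^ (1 - lam))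
    - lower_order_const d lam rho1 rho2 B * (X * W `^ (lam / 2) + W `^ (3 * lam / 2)) <= HG ->
  HG <= 2 * g / tau -> g <= K1 + K2 * tau `^ (lam / (lam - 1)).

Lemma harnack_estimate p t : 0 < t ->
  st_harnack e f lam delta p t <= K1 + K2 * (t / 2) `^ (lam / (lam - 1)).
Proof.
move=> t0; have t20 : 0 < t / 2 by rewrite divr_gt0.
have de j : derivation A (e j) by exact: vector_field_derivation.
have lam1 : lam < 1.
  by apply: lt_trans l2 _; rewrite ltr_pdivrMr // mul1r ltr_nat.
case: (lerP (st_harnack e f lam delta p t) 0) => [Gn|Gp].
  by apply: le_trans Gn _; rewrite addr_ge0 // mulr_ge0 // powR_ge0.
have sG := st_harnack_smooth atlasA ve sf lam delta.
have t2t : t / 2 < t by rewrite ltr_pdivrMr // ltr_pMr // ltr1n.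
have [q [t1 [st tT G0 Gmax Gevo]]] := parabolic_maximum atlasA cM ve t20 t2t sG Gp.
have t10 : 0 < t1 := lt_trans t20 st.
have sft : smooth A (f ^~ t1) by exact: st_slice.
have svt : smooth A (fun r => derive1 (f r) t1).
  exact: (@st_slice _ _ _ _ (fun r s => derive1 (f r) s) t1 (st_dt sf) t10).
have tau0 : 0 < t1 - t / 2 by rewrite subr_gt0.
pose W := 1 + \sum_al Y e al (f ^~ t1) q ^+ 2.
have W1 : 1 <= W by rewrite /W lerDl; apply: sumr_ge0 => al _; exact: sqr_ge0.
have low := @li_yau_evolution R d lam rho1 rho2 kappa B n M A e de a b c sa sb sc habc q
  (fun i j => le_trans (sup_coef_ge atlasA cM i j q sa) aB)
  (fun i j => le_trans (sup_coef_ge atlasA cM i j q sb) bB)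
  (fun i j => le_trans (sup_coef_ge atlasA cM i j q sc) cB)
  (fun k i j => le_trans (sup_dcoef_ge atlasA cM k i j q de sa) daB)
  (fun k i j => le_trans (sup_dcoef_ge atlasA cM k i j q de sb) dbB)
  (fun k i j => le_trans (sup_dcoef_ge atlasA cM k i j q de sc) dcB)
  B0 l1 lam1 r0 m hCD (f ^~ t1) _ sft svt (fun r => heat r t10) delta
  (Gamma e (f ^~ t1) q) W erefl erefl.
rewrite -(st_harnack_dt atlasA ve sf heat lam delta q t10) in low.
have X0 : 0 <= Gamma e (f ^~ t1) q.
  by rewrite GammaE; apply: sumr_ge0 => j _; exact: sqr_ge0.
have W0 : 0 < W := lt_le_trans ltr01 W1.
have lam0 : 0 <= lam by apply: ltW; apply: lt_trans l1; rewrite divr_gt0.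
have SN : \sum_al weight lam (Y e al (f ^~ t1) q) <= (#|Lam d|%:R + 1) * W `^ lam.
  apply: (@le_trans _ _ (#|Lam d|%:R * W `^ lam)); last first.
    by rewrite ler_wpM2r ?powR_ge0 // lerDl.
  apply: le_trans (ler_norm _) _; apply: norm_sum_le_card => al.
  rewrite ger0_norm ?powR_ge0 //; apply: ge0_ler_powR; rewrite ?nnegrE //.
  - exact: ltW (one_sqr_gt0 _).
  - exact: ltW.
  - rewrite /W lerD2l (bigD1 al) //= lerDl.
    by apply: sumr_ge0 => i _; exact: sqr_ge0.
have GE : st_harnack e f lam delta q t1 = Gamma e (f ^~ t1) q
   + \sum_al weight lam (Y e al (f ^~ t1) q) - delta * (L e (f ^~ t1) q + Gamma e (f ^~ t1) q).
  by rewrite /st_harnack /harnack heat.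
have bnd := evolution_le X0 W1 SN GE G0 tau0 low (Gevo _).
have tt : t1 - t / 2 <= t / 2 by rewrite lerBlDr -splitr.
have tE : t - t / 2 = t / 2 by rewrite {1}[t]splitr addrK.
rewrite tE in Gmax.
have t22 : 0 < (t / 2) ^+ 2 by rewrite exprn_gt0.
rewrite -(ler_pM2l t22); apply: le_trans Gmax _.
apply: (@le_trans _ _ ((t1 - t / 2) ^+ 2 * (K1 + K2 * (t1 - t / 2) `^ (lam / (lam - 1))))).
  by rewrite ler_wpM2l // sqr_ge0.
(* The squared weight is moved inside the bound. Since [2 + lam / (lam - 1) = (2 - 3 lam) / (1 -
   lam)] is nonnegative, the result increases with [s], so the elapsed time [t1 - t / 2] may be
   replaced by [t / 2]. *)
have pw (s : R) : 0 < s -> s ^+ 2 * (K1 + K2 * s `^ (lam / (lam - 1)))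
    = K1 * s ^+ 2 + K2 * s `^ (2 + lam / (lam - 1)).
  move=> s0; rewrite powR_gt0D // (powR_mulrn 2 (ltW s0)); ring.
rewrite !pw //; apply: lerD; rewrite ler_wpM2l //.
  by rewrite ler_pXn2r // nnegrE ltW.
apply: ge0_ler_powR; rewrite ?nnegrE ?(ltW tau0) ?(ltW t20) //.
have n1 : lam - 1 != 0 by rewrite subr_eq0 lt_eqF.
have -> : 2 + lam / (lam - 1) = (2 - 3 * lam) / (1 - lam).
  by field; rewrite n1 -opprB oppr_eq0 n1.
rewrite divr_ge0 // subr_ge0 ltW // mulrC.
by rewrite -ltr_pdivlMr.
Qed.

End HarnackEstimate.

(** * Choice of the constants and return from [ln u] to [u] *)

Unset Implicit Arguments.

Theorem theorem1p4 (R : realType) (d : nat) (lambda rho1 rho2 kappa : R)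
    (hlambda1 : 1 / 2 < lambda) (hlambda2 : lambda < 2 / 3)
    (hrho2 : 0 < rho2) (hkappa : 0 <= kappa) :
  exists delta0 : int -> R, (forall h : int, 1 < delta0 h) /\
  forall (m : R) (hm : 0 < m) (delta sa sa' sb sb' sc sc' : R),
  exists C1 C2 C3 : R, [/\ 0 < C1, 0 < C2 & 0 < C3] /\
  forall (h : int) (hdelta : delta0 h < delta)
    (n : nat) (hn : d%:Z + h = n%:Z)
    (M : ptopologicalType) (A : set (chart R n M))
    (hM : closed_connected_manifold A)
    (mu : {measure set (g_sigma_algebraType (@open M)) -> \bar R})
    (e : 'I_d -> (M -> R) -> (M -> R))
    (he : forall j, vector_field A (e j))
    (hspan : spans_tangent_space A e)
    (a : idx4 d -> 'I_d -> M -> R)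
    (b : idx4 d -> idx2 d -> M -> R)
    (c : idx4 d -> idx3 d -> M -> R)
    (ha : forall q k, smooth A (a q k))
    (hb : forall q eta, smooth A (b q eta))
    (hc : forall q B, smooth A (c q B))
    (habc : bracket4_expansion A e a b c)
    (hsa : sa = sup_coef a) (hsa' : sa' = sup_dcoef e a)
    (hsb : sb = sup_coef b) (hsb' : sb' = sup_dcoef e b)
    (hsc : sc = sup_coef c) (hsc' : sc' = sup_dcoef e c)
    (hCD : CD A e rho1 rho2 kappa m)
    (u : M -> R -> R)
    (hreg : spacetime_regular A u)
    (hpos : forall (p : M) (t : R), 0 <= t -> 0 < u p t)
    (hheat : forall (p : M) (t : R), 0 < t -> L e (u ^~ t) p - derive1 (u p) t = 0),
  forall (p : M) (t : R), 0 < t ->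
    \sum_(j < d) `|e j (u ^~ t) p| ^+ 2 / u p t ^+ 2
    + \sum_(al : Lam d)
        (1 + `|Y e al (u ^~ t) p| ^+ 2 / u p t ^+ 2) `^ lambda
    - delta * (derive1 (u p) t / u p t)
    <= C1 / t + C2 + C3 * t `^ (lambda / (lambda - 1)).
Proof.
pose N : R := #|Lam d|%:R + 1.
pose Cs := diffusion_const d lambda kappa.
have N0 : 0 < N by rewrite ltr_wpDl.
have lam1 : lambda < 1.
  by apply: lt_trans hlambda2 _; rewrite ltr_pdivrMr // mul1r ltr_nat.
have eps0 : 0 < gradient_const lambda by exact: gradient_const_gt0.
have Cs0 : 0 <= Cs.
  by rewrite addr_ge0 // divr_ge0 ?(ltW eps0) // mulr_ge0 // sqr_ge0.
have NCs : 0 <= 4 * N * Cs / rho2.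
  by rewrite divr_ge0 ?(ltW hrho2) // mulr_ge0 // mulr_ge0 // ltW.
(* The quotient is the threshold at which [rho2 W] absorbs the critical term; the summand [2] makes
   the value exceed [1]. *)
exists (fun=> 2 + 4 * N * Cs / rho2); split=> [_|m hm delta sa sa' sb sb' sc sc'].
  by rewrite ltr_wpDr // ltr1n.
(* The constants are requested before [delta] is known to exceed the threshold; below it any
   positive constants do, as the later hypothesis is contradictory. *)
case: (ltP (2 + 4 * N * Cs / rho2) delta) => hd; last first.
  exists 1, 1, 1; split; first by split.
  by move=> h hdelta.
(* One nonnegative number bounding all six suprema, built from the parameters alone, since the
   manifold is not yet introduced. *)
pose B : R := `|sa| + `|sa'| + `|sb| + `|sb'| + `|sc| + `|sc'|.
have B0 : 0 <= B by rewrite /B !addr_ge0.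
pose C := lower_order_const d lambda rho1 rho2 B.
have ct0 := commutator_const_ge0 d B hlambda1.
have tt0 := torsion_const_ge0 d B0 hlambda1.
have C0 : 0 <= C.
  rewrite /C /lower_order_const.
  have := ct0; have := tt0; move: (commutator_const _ _ _) (torsion_const _ _ _) => x y y0 x0.
  have q0 : 0 <= x ^+ 2 / (2 * gradient_const lambda).
    by rewrite divr_ge0 ?sqr_ge0 // mulr_ge0 // ltW.
  have r0 := ltW hrho2; nonneg.
have d1 : 1 < delta by apply: lt_trans hd; rewrite ltr_wpDr // ltr1n.
have dl : 4 * N * Cs / rho2 <= delta - 1.
  rewrite lerBrDl; apply: le_trans (ltW hd); by rewrite lerD2r ler1n.
have [K1 [K2 [K10 K20 bnd]]] :=
  evolution_bound hlambda1 hlambda2 hrho2 hm Cs0 C0 N0 d1 dl.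
pose q := lambda / (lambda - 1).
(* The estimate already has the form of a constant plus a power of [t / 2]; the factor [2^-1] to the
   power [q] comes from that half, and the ones only secure positivity. *)
exists 1, (K1 + 1), (K2 * 2^-1 `^ q + 1); split.
  by split=> //; rewrite ltr_wpDl // mulr_ge0 // powR_ge0.
move=> h hdelta n hn M A hM mu e he hspan a b c ha hb hc habc.
move=> hsa hsa' hsb hsb' hsc hsc' hCD u hreg hpos hheat p t t0.
have [_ cM _ atlasA] := hM.
have de j : derivation A (e j) by exact: vector_field_derivation.
pose f p s := ln (u p s).
have su : st_smooth A u by exact: hreg.2.
have upos p' s : 0 < s -> 0 < u p' s by move=> s0; apply: hpos; exact: ltW.
have sf : st_smooth A f by exact: st_ln.
have ut p' s : 0 < s -> derive1 (f p') s = (u p' s)^-1 * derive1 (u p') s.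
  move=> s0; rewrite derive1E.
  have [_ ->] // := @is_derive1_comp R (@ln R) (u p') s _ _
    (is_derive1_ln (upos p' s s0)) (st_is_derive atlasA p' su s0).
have heat p' s : 0 < s -> derive1 (f p') s = L e (f ^~ s) p' + Gamma e (f ^~ s) p'.
  move=> s0; rewrite (log_laplacian p' de (st_slice su s0) (fun r => upos r s s0)) ut //.
  by have /eqP := hheat p' s s0; rewrite subr_eq0 => /eqP ->.
have leB x : x \in [:: sa; sa'; sb; sb'; sc; sc'] -> x <= B.
  move=> xs; apply: le_trans (ler_norm x) _.
  have -> : B = \sum_(y <- [:: sa; sa'; sb; sb'; sc; sc']) `|y|.
    by rewrite !big_cons big_nil addr0 /B !addrA.
  by rewrite (big_rem x) //= lerDl sumr_ge0.
have main := @harnack_estimate R n d M A e atlasA cM he a b c ha hb hc habc B.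
rewrite -hsa -hsa' -hsb -hsb' -hsc -hsc' in main.
have {}main := main (leB sa _) (leB sb _) (leB sc _) (leB sa' _) (leB sb' _) (leB sc' _)
  B0 lambda rho1 rho2 kappa m delta hlambda1 hlambda2 (ltW hrho2) hCD f sf heat K1 K2 K10 K20 bnd p t t0.
have {}main : st_harnack e f lambda delta p t <= K1 + K2 * (t / 2) `^ q.
  by apply: main; rewrite !inE eqxx ?orbT.
(* Every quotient by [u] is a derivative of [ln u], so the left-hand side is the Harnack quantity
   itself. *)
have -> : \sum_(j < d) `|e j (u ^~ t) p| ^+ 2 / u p t ^+ 2
    + \sum_(al : Lam d) (1 + `|Y e al (u ^~ t) p| ^+ 2 / u p t ^+ 2) `^ lambda
    - delta * (derive1 (u p) t / u p t) = st_harnack e f lambda delta p t.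
  have dln X : derivation A X -> `|X (u ^~ t) p| ^+ 2 / u p t ^+ 2 = X (f ^~ t) p ^+ 2.
    move=> dX; rewrite (der_ln dX p (st_slice su t0) (fun r => upos r t t0)).
    by rewrite real_normK ?num_real // exprMn exprVn mulrC.
  rewrite /st_harnack /harnack GammaE ut // [_^-1 * _]mulrC; congr (_ + _ - _).
    by apply: eq_bigr => j _; exact: dln.
  by apply: eq_bigr => al _; rewrite dln //; exact: derivation_Y.
apply: le_trans main _.
have -> : (t / 2) `^ q = 2^-1 `^ q * t `^ q by rewrite powRM ?(ltW t0) // mulrC.
have i0 : 0 <= 1 / t by rewrite divr_ge0 // ltW.
rewrite -/q -subr_ge0.
have -> : 1 / t + (K1 + 1) + (K2 * 2^-1 `^ q + 1) * t `^ q
    - (K1 + K2 * (2^-1 `^ q * t `^ q)) = 1 / t + (1 + t `^ q) by ring.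
by rewrite !addr_ge0 // powR_ge0.
Qed.
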